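(* Let $k$ be a field of characteristic zero, let $a\in k[h]$ be a non-constant polynomial, let $h_0\in k\setminus\{0\}$ and let $\sigma$ be the $k$-algebra automorphism of $k[h]$ with $\sigma(h)=h-h_0$. Let $A=A(k[h],a,\sigma)$ be the generalized Weyl algebra, put $n=\deg a$ and $d=\deg(a;a')$, where $a'$ is the formal derivative of $a$ and $(a;a')$ is the (monic) greatest common divisor of $a$ and $a'$. Then for the Hochschild homology $H\!H_*(A)=\operatorname{Tor}^{A\otimes A^{op}}_*(A,A)$: \begin{itemize} \item if $(a;a')=1$ (i.e. $d=0$), then $\dim_k H\!H_0(A)=n-1$, $\dim_k H\!H_2(A)=1$, and $H\!H_i(A)=0$ for $i\neq 0,2$; \item if $d\geq 1$, then $\dim_k H\!H_0(A)=n-1$, $\dim_k H\!H_1(A)=d-1$, and $\dim_k H\!H_i(A)=d$ for all $i\geq 2$. \end{itemize}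
   Context: For a $k$-algebra $R$, a central element $a\in R$ and $\sigma\in\mathrm{Aut}_k(R)$, the generalized Weyl algebra $A(R,a,\sigma)$ is the $k$-algebra generated by $R$ and two new variables $x,y$ subject to the relations $yx=a$, $xy=\sigma(a)$, $xr=\sigma(r)x$ and $ry=y\sigma(r)$ for all $r\in R$. Here $R=k[h]$. *)

(* Defs.v *)
From HB Require Import structures.
From mathcomp Require Import all_boot all_order all_algebra.
From mathcomp Require Import finmap.
From mathcomp.multinomials Require Import monalg.
Set Implicit Arguments. Unset Strict Implicit. Unset Printing Implicit Defensive.
Import Order.TTheory GRing.Theory Num.Theory.
Local Open Scope ring_scope.

(* The generalized Weyl algebra A = A(k[h], a, sigma), sigma(h) = h - h0,
   realised concretely through its standard k-basis
     { h^e w_j : e in nat, j in int },   w_j = x^j (j >= 0),  w_j = y^(-j) (j < 0).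
   The basis element h^e w_j is encoded by the key (j, e) : int * nat, and an
   element of A (resp. of A^{(x) (n+1)}) is a finitely supported k-linear
   combination of keys (resp. of (n+1)-tuples of keys), i.e. an element of the
   free k-module {malg k[K]}. *)

Definition gwa_key := (int * nat)%type.

Section GWA.
Variables (k : fieldType) (a : {poly k}) (h0 : k).

Definition sigmaz (l : int) (p : {poly k}) : {poly k} :=
  p \Po ('X - (l%:~R * h0)%:P).

(* w_i w_j = wcoef i j * w_(i+j) *)
Definition wcoef (i j : int) : {poly k} :=
  match i, j with
  | Posz i', Negz m' =>
      (* x^i y^m, m = m'+1, t = min i m : prod_(s<t) sigma^(i-s)(a) *)
      let t := minn i' m'.+1 in
      \prod_(s < t) sigmaz (i'%:Z - (s : nat)%:Z) a
  | Negz m', Posz j' =>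
      (* y^m x^j, m = m'+1, t = min m j : prod_(s<t) sigma^(-(m-t)-s)(a) *)
      let m := m'.+1 in let t := minn m j' in
      \prod_(s < t) sigmaz (- ((m - t)%:Z + (s : nat)%:Z)) a
  | _, _ => 1
  end.

Definition GWA := {malg k[gwa_key]}.

Definition polyw (j : int) (p : {poly k}) : GWA :=
  \sum_(e < size p) << p`_e *g ((j, (e : nat)) : gwa_key) >>.

(* product of basis elements: (h^e1 w_j1)(h^e2 w_j2) = h^e1 sigma^j1(h^e2) w_j1 w_j2 *)
Definition bmul (b1 b2 : gwa_key) : GWA :=
  polyw (b1.1 + b2.1) ('X^(b1.2) * sigmaz b1.1 ('X^(b2.2)) * wcoef b1.1 b2.1).

Definition hchain (n : nat) := {malg k[n.+1.-tuple gwa_key]}.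

Definition key0 : gwa_key := (0%:Z, 0%N).

Definition hmerge (n : nat) (t : n.+2.-tuple gwa_key) (i : nat) : hchain n :=
  let p := bmul (nth key0 t i) (nth key0 t i.+1) in
  \sum_(b <- msupp p)
    << p@_b *g [tuple (if ((j : nat) < i)%N then nth key0 t j
                       else if ((j : nat) == i)%N then b
                       else nth key0 t (j : nat).+1) | j < n.+1] >>.

Definition hcyc (n : nat) (t : n.+2.-tuple gwa_key) : hchain n :=
  let p := bmul (nth key0 t n.+1) (nth key0 t 0) in
  \sum_(b <- msupp p)
    << p@_b *g [tuple (if (j : nat) == 0%N then b else nth key0 t j) | j < n.+1] >>.

Definition hbd_basis (n : nat) (t : n.+2.-tuple gwa_key) : hchain n :=
  \sum_(i < n.+1) (-1) ^+ i *: hmerge t i + (-1) ^+ n.+1 *: hcyc t.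

Definition hbd (n : nat) (f : hchain n.+1) : hchain n :=
  \sum_(t <- msupp f) f@_t *: hbd_basis t.

Definition hcycle (n : nat) : hchain n -> Prop :=
  match n with
  | 0%N => fun _ => True
  | m.+1 => fun z => hbd z = 0
  end.

Definition hboundary (n : nat) (z : hchain n) : Prop :=
  exists w : hchain n.+1, hbd w = z.

Definition HH_dim (n d : nat) : Prop :=
  exists zs : 'I_d -> hchain n,
    [/\ forall i, hcycle (zs i),
        forall z, hcycle z ->
          exists c : 'I_d -> k, hboundary (z - \sum_(i < d) c i *: zs i)
      & forall c : 'I_d -> k,
          hboundary (\sum_(i < d) c i *: zs i) -> forall i, c i = 0].

End GWA.

(* Main.v *)
(* Write R = k[h].  The algebra A has a small free bimodule resolution P, with one
   generator [u] for every word u alternating in x and y (degree: the length of u)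
   and one generator [uh] for every such word (degree: the length plus one):
   u stands for iterated overlaps of the relations yx = a, xy = sigma(a), and h
   for the commutation of u with R.  A comparison of P with the bar resolution
   reduces HH(A) to the complex A (x)_{A^e} P.  There the commutator with h acts
   on the part of total weight w (deg x = 1, deg y = -1) as w h0, so only weight 0
   survives, and each generator contributes one copy of R.  Contracting the
   remaining acyclic pairs leaves R in degree 0 and R^2 in every positive degree,
   the differentials being built from multiplication by a and a', and, in low
   degrees, from sigma - 1, which is onto R with kernel k.  The homology is then
   read off from a Bezout relation for (a; a'). *)

Require Import Defs.
From HB Require Import structures.
From mathcomp Require Import all_boot all_order all_algebra.
From mathcomp Require Import finmap zify ring.
From mathcomp.multinomials Require Import monalg.
Set Implicit Arguments. Unset Strict Implicit. Unset Printing Implicit Defensive.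
Import GRing.Theory.
Local Open Scope ring_scope.

(** * Free bimodules over an algebra with a basis *)

(** Every module is free over k on explicit keys, so bimodule maps and the maps they induce on
    coinvariants are given by values on generators. Exactness of P comes from an explicit
    contracting homotopy s. The same s yields d d = 0, the lifts between P and the bar resolution,
    and the homotopies between lifts, so none of these has to be computed. What shapes P is that the
    relations have coefficients in R: both reductions of the overlap xyx agree only after a is moved
    past x, and a twisted derivation applied to a records this move. In weight 0 its twist cancels
    and its i summands on h^i become equal, so it turns into multiplication by the derivative; this
    is where a' comes from. The operator sigma - 1 occurs only in low degrees because the empty word
    is a single generator, while in positive length the words ending in x and in y are separate.
    Characteristic zero enters twice: w h0 is invertible for non-zero w, and sigma - 1 lowers the
    degree of a non-constant polynomial by exactly one. *)

Definition mklin (k : nzRingType) (U V : lmodType k) (f : U -> V) (lf : linear f) :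
  {linear U -> V} := HB.pack f (GRing.isLinear.Build k U V _ f lf).

Section LinearFacts.
Variables (k : nzRingType) (U V : lmodType k) (f : U -> V).
Hypothesis lf : linear f.
Lemma lin0 : f 0 = 0. Proof. exact: (linear0 (mklin lf)). Qed.
Lemma linD : {morph f : u v / u + v}. Proof. exact: (linearD (mklin lf)). Qed.
Lemma linB : {morph f : u v / u - v}. Proof. exact: (linearB (mklin lf)). Qed.
Lemma linN : {morph f : u / - u}. Proof. exact: (linearN (mklin lf)). Qed.
Lemma linZ (c : k) u : f (c *: u) = c *: f u.
Proof. exact: (linearZ_LR (mklin lf)). Qed.
Lemma lin_sum I (r : seq I) (P : pred I) (u : I -> U) :
  f (\sum_(i <- r | P i) u i) = \sum_(i <- r | P i) f (u i).
Proof. exact: (linear_sum (mklin lf)). Qed.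
End LinearFacts.

(** * Linear extension of maps defined on a basis *)

HB.lock Definition mext (k : fieldType) (X : choiceType) (M : lmodType k)
    (f : X -> M) (m : {malg k[X]}) : M :=
  \sum_(x <- msupp m) m@_x *: f x.

Section LinearExtension.
Variables (k : fieldType) (X : choiceType).

Lemma mextE (M : lmodType k) (f : X -> M) (m : {malg k[X]}) :
  mext f m = \sum_(x <- msupp m) m@_x *: f x.
Proof. by rewrite unlock. Qed.

Variable M : lmodType k.
Implicit Type f g : X -> M.

Lemma mextEw f (D : {fset X}) (m : {malg k[X]}) : (msupp m `<=` D)%fset ->
  mext f m = \sum_(x <- D) m@_x *: f x.
Proof.
move=> sD; rewrite mextE (big_fset_incl _ sD) // => x _.
by rewrite -mcoeff_eq0 => /eqP ->; rewrite scale0r.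
Qed.

Lemma mext_is_linear f : linear (mext f).
Proof.
move=> c m1 m2.
pose D := (msupp (c *: m1 + m2) `|` (msupp m1 `|` msupp m2))%fset.
have s1 : (msupp m1 `<=` D)%fset.
  by apply/fsubsetP => x; rewrite !inE => ->; rewrite orbT.
have s2 : (msupp m2 `<=` D)%fset.
  by apply/fsubsetP => x; rewrite !inE => ->; rewrite !orbT.
rewrite (@mextEw f D) ?fsubsetUl // (mextEw f s1) (mextEw f s2) scaler_sumr -big_split /=.
by apply: eq_bigr => x _; rewrite mcoeffD mcoeffZ scalerDl scalerA.
Qed.

HB.instance Definition _ f :=
  GRing.isLinear.Build k {malg k[X]} M _ (mext f) (mext_is_linear f).

Lemma mextU f x : mext f << x >> = f x.
Proof. by rewrite mextE msuppU oner_eq0 big_seq_fset1 mcoeffUU scale1r. Qed.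

Lemma mextZU f c x : mext f << c *g x >> = c *: f x.
Proof.
have -> : << c *g x >> = c *: << x >> :> {malg k[X]}.
  by apply/malgP => y; rewrite mcoeffZ !mcoeffU; case: (x == y); rewrite ?mulr1 ?mulr0.
by rewrite linearZ /= mextU.
Qed.

Lemma eq_mext f g : f =1 g -> mext f =1 mext g.
Proof. by move=> e m; rewrite !mextE; apply: eq_bigr => x _; rewrite e. Qed.

Lemma malg_linE (m : {malg k[X]}) : m = \sum_(x <- msupp m) m@_x *: << x >>.
Proof.
rewrite {1}[m]monalgE; apply: eq_bigr => x _.
by apply/malgP => y; rewrite mcoeffZ !mcoeffU; case: (x == y); rewrite ?mulr1 ?mulr0.
Qed.

Lemma malg_lin_ext (F G : {malg k[X]} -> M) : linear F -> linear G ->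
  (forall x, F << x >> = G << x >>) -> F =1 G.
Proof.
move=> lF lG e m; rewrite [m]malg_linE (lin_sum lF) (lin_sum lG); apply: eq_bigr => x _.
by rewrite (linZ lF) (linZ lG) e.
Qed.

Lemma lin_mext (N : lmodType k) (F : M -> N) f m : linear F ->
  F (mext f m) = mext (fun x => F (f x)) m.
Proof.
by move=> lF; rewrite !mextE (lin_sum lF); apply: eq_bigr => x _; rewrite (linZ lF).
Qed.

Lemma mext_fun_is_linear (N : lmodType k) (f : X -> N -> M) m :
  (forall x, linear (f x)) -> linear (fun v => mext (f^~ v) m).
Proof.
move=> lf c u v; rewrite !mextE scaler_sumr -big_split /=; apply: eq_bigr => x _.
by rewrite lf scalerDr !scalerA mulrC.
Qed.

End LinearExtension.

Lemma mext_id (k : fieldType) (X : choiceType) (m : {malg k[X]}) :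
  mext (fun x => << x >>) m = m.
Proof. by rewrite mextE -malg_linE. Qed.

(** * Algebras given by structure constants on a basis that contains the unit *)

Structure basedAlg (k : fieldType) := BasedAlg {
  bkey : choiceType;
  bone : bkey;
  bmu : bkey -> bkey -> {malg k[bkey]};
  bmu1l : forall x, bmu bone x = << x >>;
  bmu1r : forall x, bmu x bone = << x >>;
  bmuA : forall x y z,
    mext (fun u => bmu u z) (bmu x y) = mext (fun u => bmu x u) (bmu y z) }.

Definition balg (k : fieldType) (B : basedAlg k) : Type := {malg k[bkey B]}.

HB.lock Definition bas (k : fieldType) (B : basedAlg k) (x : bkey B) : balg B :=
  << x >>.

Section BasedAlgebra.
Variables (k : fieldType) (B : basedAlg k).
HB.instance Definition _ := GRing.Lmodule.on (balg B).
Local Notation A := (balg B).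

Local Notation bas := (@bas k B).
Definition balg_mul (b c : A) : A :=
  mext (fun x => mext (fun y => bmu x y) c) b.

Lemma basE x : bas x = << x >>. Proof. by rewrite unlock. Qed.

Definition balg_one : A := bas (bone B).

Lemma balg_mulU x y : balg_mul << x >> << y >> = bmu x y.
Proof. by rewrite /balg_mul !mextU. Qed.

Lemma balg_mul_is_linearl c : linear (balg_mul^~ c).
Proof. exact: mext_is_linear. Qed.
Lemma balg_mul_is_linearr b : linear (balg_mul b).
Proof. apply: mext_fun_is_linear => x; exact: mext_is_linear. Qed.

Lemma balg_mulA : associative balg_mul.
Proof.
move=> b c d; move: b; apply: malg_lin_ext => [e u v|e u v|x].
- by rewrite balg_mul_is_linearl.
- by rewrite !balg_mul_is_linearl.
move: c; apply: malg_lin_ext => [e u v|e u v|y].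
- by rewrite balg_mul_is_linearl balg_mul_is_linearr.
- by rewrite balg_mul_is_linearr balg_mul_is_linearl.
move: d; apply: malg_lin_ext => [e u v|e u v|z].
- by rewrite !balg_mul_is_linearr.
- by rewrite !balg_mul_is_linearr.
rewrite !balg_mulU {1}/balg_mul mextU -bmuA /balg_mul.
by apply: eq_mext => u; rewrite mextU.
Qed.

Lemma balg_mul1l : left_id balg_one balg_mul.
Proof.
move=> b; rewrite /balg_mul /balg_one basE mextU -[RHS]mext_id.
by apply: eq_mext => x; rewrite bmu1l.
Qed.

Lemma balg_mul1r : right_id balg_one balg_mul.
Proof.
move=> b; rewrite /balg_mul -[RHS]mext_id.
by apply: eq_mext => x; rewrite /balg_one basE mextU bmu1r.
Qed.

Lemma balg_mulDl : left_distributive balg_mul +%R.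
Proof. by move=> b c d; rewrite -[b]scale1r balg_mul_is_linearl !scale1r. Qed.
Lemma balg_mulDr : right_distributive balg_mul +%R.
Proof. by move=> b c d; rewrite -[c]scale1r balg_mul_is_linearr !scale1r. Qed.
Lemma balg_one_neq0 : balg_one != 0.
Proof.
apply/eqP => /(congr1 (mcoeff (bone B))); rewrite /balg_one basE mcoeff0 mcoeffUU => /eqP.
by rewrite oner_eq0.
Qed.

HB.instance Definition _ := GRing.Zmodule_isNzRing.Build A
  balg_mulA balg_mul1l balg_mul1r balg_mulDl balg_mulDr balg_one_neq0.
Lemma balg_scalerAl (c : k) (u v : A) : c *: (u * v) = (c *: u) * v.
Proof. exact/esym/(linZ (balg_mul_is_linearl v)). Qed.
HB.instance Definition _ := GRing.Lmodule_isLalgebra.Build k A balg_scalerAl.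
Lemma balg_scalerAr (c : k) (u v : A) : c *: (u * v) = u * (c *: v).
Proof. exact/esym/(linZ (balg_mul_is_linearr u)). Qed.
HB.instance Definition _ := GRing.Lalgebra_isAlgebra.Build k A balg_scalerAr.

Lemma basM x y : bas x * bas y = bmu x y.
Proof. by rewrite !basE; exact: balg_mulU. Qed.
Lemma balg_lin_ext (M : lmodType k) (F G : A -> M) : linear F -> linear G ->
  (forall x, F (bas x) = G (bas x)) -> F =1 G.
Proof.
move=> lF lG e; apply: (@malg_lin_ext k _ M F G) => // x.
by rewrite -basE e.
Qed.

End BasedAlgebra.

(* For a set E, the free A-bimodule A (x) kE (x) A has the basis K * E * K, where K
   is the basis of A, and its coinvariants A (x)_{A^e} (A (x) kE (x) A) = A (x) kE
   have the basis K * E.  [ten b e c] is b (x) e (x) c, [act b c m] is b m c, [cten]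
   is the tensor in A (x) kE, [tr] is the projection b (x) e (x) c |-> cb (x) e, and
   [bext g], [cind g] are the maps induced by g on bimodules and on coinvariants. *)
HB.lock Definition ten (k : fieldType) (B : basedAlg k) (E : choiceType)
    (b : balg B) (e : E) (c : balg B) : {malg k[(bkey B * E * bkey B)%type]} :=
  mext (fun x => mext (fun y => << (x, e, y) >>) c) b.

HB.lock Definition act (k : fieldType) (B : basedAlg k) (E : choiceType)
    (b c : balg B) (m : {malg k[(bkey B * E * bkey B)%type]}) : {malg k[(bkey B * E * bkey B)%type]} :=
  mext (fun t => ten (b * bas t.1.1) t.1.2 (bas t.2 * c)) m.

HB.lock Definition bext (k : fieldType) (B : basedAlg k) (E E' : choiceType)
    (g : E -> {malg k[(bkey B * E' * bkey B)%type]}) (m : {malg k[(bkey B * E * bkey B)%type]}) : {malg k[(bkey B * E' * bkey B)%type]} :=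
  mext (fun t => act (bas t.1.1) (bas t.2) (g t.1.2)) m.

HB.lock Definition cten (k : fieldType) (B : basedAlg k) (E : choiceType)
    (c : balg B) (e : E) : {malg k[(bkey B * E)%type]} :=
  mext (fun x => << (x, e) >>) c.

HB.lock Definition tr (k : fieldType) (B : basedAlg k) (E : choiceType)
    (m : {malg k[(bkey B * E * bkey B)%type]}) : {malg k[(bkey B * E)%type]} :=
  mext (fun t => cten (bas t.2 * bas t.1.1) t.1.2) m.

HB.lock Definition cind (k : fieldType) (B : basedAlg k) (E E' : choiceType)
    (g : E -> {malg k[(bkey B * E' * bkey B)%type]}) (z : {malg k[(bkey B * E)%type]}) : {malg k[(bkey B * E')%type]} :=
  mext (fun t => tr (act (bas t.1) 1 (g t.2))) z.

HB.lock Definition gen (k : fieldType) (B : basedAlg k) (E : choiceType) (e : E) : {malg k[(bkey B * E * bkey B)%type]} :=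
  ten 1 e 1.

Section FreeBimodule.
Variables (k : fieldType) (B : basedAlg k).
Local Notation A := (balg B).
Local Notation "'F' E" := {malg k[(bkey B * E * bkey B)%type]} (at level 10, E at level 9).
Local Notation "'C' E" := {malg k[(bkey B * E)%type]} (at level 10, E at level 9).

Lemma mulPl (c : A) : linear (fun b : A => b * c).
Proof. exact: balg_mul_is_linearl. Qed.
Lemma mulPr (b : A) : linear (fun c : A => b * c).
Proof. exact: balg_mul_is_linearr. Qed.

Section OneSet.
Variable E : choiceType.
Local Notation ten := (@ten k B E).
Local Notation act := (@act k B E).
Local Notation gen := (@gen k B E).
Local Notation cten := (@cten k B E).
Local Notation tr := (@tr k B E).

Lemma tenU x e y : ten (bas x) e (bas y) = << (x, e, y) >>.
Proof. by rewrite ten.unlock !basE !mextU. Qed.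
Lemma tenPl e c : linear (fun b => ten b e c).
Proof. rewrite ten.unlock; exact: mext_is_linear. Qed.
Lemma tenPr b e : linear (ten b e).
Proof. by rewrite ten.unlock; apply: mext_fun_is_linear => x; apply: mext_is_linear. Qed.

Lemma bimod_ext (M : lmodType k) (f g : F E -> M) : linear f -> linear g ->
  (forall x e y, f (ten (bas x) e (bas y)) = g (ten (bas x) e (bas y))) -> f =1 g.
Proof.
by move=> lf lg e; apply: malg_lin_ext => // -[[x u] y]; rewrite -tenU.
Qed.

Lemma actP b c : linear (act b c).
Proof. rewrite act.unlock; exact: mext_is_linear. Qed.
Lemma actPl c m : linear (fun b => act b c m).
Proof. by rewrite act.unlock; apply: (mext_fun_is_linear) => t e u v; rewrite mulPl tenPl. Qed.
Lemma actPr b m : linear (fun c => act b c m).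
Proof. by rewrite act.unlock; apply: (mext_fun_is_linear) => t e u v; rewrite mulPr tenPr. Qed.

Lemma act_ten b c b' e c' : act b c (ten b' e c') = ten (b * b') e (c' * c).
Proof.
move: b'; apply: balg_lin_ext => [d u v|d u v|x].
- by rewrite tenPl actP.
- by rewrite mulPr tenPl.
move: c'; apply: balg_lin_ext => [d u v|d u v|y].
- by rewrite tenPr actP.
- by rewrite mulPl tenPr.
by rewrite tenU act.unlock mextU.
Qed.

Lemma act_act b c b' c' m : act b c (act b' c' m) = act (b * b') (c' * c) m.
Proof.
move: m; apply: bimod_ext => [d u v|d u v|x e y].
- by rewrite !actP.
- by rewrite !actP.
by rewrite !act_ten !mulrA.
Qed.

Lemma act11 m : act 1 1 m = m.
Proof.
move: m; apply: bimod_ext => [d u v|//|x e y].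
- by rewrite actP.
by rewrite act_ten mul1r mulr1.
Qed.

Lemma act_gen b c e : act b c (gen e) = ten b e c.
Proof. by rewrite gen.unlock act_ten mulr1 mul1r. Qed.

Lemma act0 b c : act b c 0 = 0.
Proof. exact: (lin0 (actP b c)). Qed.
Lemma actD b c : {morph act b c : m n / m + n}.
Proof. exact: (linD (actP b c)). Qed.
Lemma actB b c : {morph act b c : m n / m - n}.
Proof. exact: (linB (actP b c)). Qed.
Lemma actN b c : {morph act b c : m / - m}.
Proof. exact: (linN (actP b c)). Qed.
Lemma actZ b c (x : k) m : act b c (x *: m) = x *: act b c m.
Proof. exact: (linZ (actP b c)). Qed.
Lemma act_sum b c I (r : seq I) (P : pred I) (f : I -> F E) :
  act b c (\sum_(i <- r | P i) f i) = \sum_(i <- r | P i) act b c (f i).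
Proof. exact: (lin_sum (actP b c)). Qed.

Lemma ctenU x e : cten (bas x) e = << (x, e) >>.
Proof. by rewrite cten.unlock basE mextU. Qed.
Lemma ctenP e : linear (cten^~ e).
Proof. rewrite cten.unlock; exact: mext_is_linear. Qed.
Lemma coinv_ext (M : lmodType k) (f g : C E -> M) : linear f -> linear g ->
  (forall c e, f (cten c e) = g (cten c e)) -> f =1 g.
Proof.
by move=> lf lg e; apply: malg_lin_ext => // -[x u]; rewrite -ctenU.
Qed.

Lemma coinv_bas_ext (M : lmodType k) (f g : C E -> M) : linear f -> linear g ->
  (forall x e, f (cten (bas x) e) = g (cten (bas x) e)) -> f =1 g.
Proof.
by move=> lf lg e; apply: malg_lin_ext => // -[x u]; rewrite -ctenU.
Qed.

Lemma trP : linear tr.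
Proof. rewrite tr.unlock; exact: mext_is_linear. Qed.

Lemma trD : {morph tr : m n / m + n}.
Proof. exact: (linD trP). Qed.
Lemma trB : {morph tr : m n / m - n}.
Proof. exact: (linB trP). Qed.
Lemma trZ (x : k) m : tr (x *: m) = x *: tr m.
Proof. exact: (linZ trP). Qed.

Lemma tr_ten b e c : tr (ten b e c) = cten (c * b) e.
Proof.
move: b; apply: balg_lin_ext => [d u v|d u v|x].
- by rewrite tenPl trP.
- by rewrite mulPr ctenP.
move: c; apply: balg_lin_ext => [d u v|d u v|y].
- by rewrite tenPr trP.
- by rewrite mulPl ctenP.
by rewrite tenU tr.unlock mextU.
Qed.

(** Cyclicity of coinvariants: a factor on the far right may be carried to the far left. *)
Lemma tr_act b c m : tr (act b c m) = tr (act (c * b) 1 m).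
Proof.
move: m; apply: bimod_ext => [d u v|d u v|x e y].
- by rewrite actP trP.
- by rewrite actP trP.
by rewrite !act_ten !tr_ten !mulr1 !mulrA.
Qed.

End OneSet.

Section TwoSets.
Variables E E' : choiceType.
Implicit Types f g : E -> F E'.
Local Notation bext := (@bext k B E E').
Local Notation cind := (@cind k B E E').

Lemma bextP g : linear (bext g).
Proof. rewrite bext.unlock; exact: mext_is_linear. Qed.

Lemma bext_ten g b e c : bext g (ten b e c) = act b c (g e).
Proof.
move: b; apply: balg_lin_ext => [d u v|d u v|x].
- by rewrite tenPl bextP.
- by rewrite actPl.
move: c; apply: balg_lin_ext => [d u v|d u v|y].
- by rewrite tenPr bextP.
- by rewrite actPr.
by rewrite tenU bext.unlock mextU.
Qed.

Lemma bext_gen g e : bext g (gen B e) = g e.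
Proof. by rewrite gen.unlock bext_ten act11. Qed.

Lemma bext_act g b c m : bext g (act b c m) = act b c (bext g m).
Proof.
move: m; apply: bimod_ext => [d u v|d u v|x e y].
- by rewrite !(actP, bextP).
- by rewrite !(actP, bextP).
by rewrite act_ten !bext_ten act_act.
Qed.

Lemma bext0 g : bext g 0 = 0.
Proof. exact: (lin0 (bextP g)). Qed.
Lemma bextD g : {morph bext g : m n / m + n}.
Proof. exact: (linD (bextP g)). Qed.
Lemma bextB g : {morph bext g : m n / m - n}.
Proof. exact: (linB (bextP g)). Qed.
Lemma eq_bext f g : f =1 g -> bext f =1 bext g.
Proof. by move=> e m; rewrite bext.unlock; apply: eq_mext => t; rewrite e. Qed.

Lemma bext_sub f g m : bext (fun e => f e - g e) m = bext f m - bext g m.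
Proof.
move: m; apply: bimod_ext => [d u v|d u v|x e y].
- by rewrite !bextP.
- by rewrite !bextP scalerBr opprD addrACA.
by rewrite !bext_ten actB.
Qed.

Lemma bext_fun0 m : bext (fun=> 0) m = 0.
Proof.
move: m; apply: bimod_ext => [d u v|d u v|x e y].
- by rewrite !bextP.
- by rewrite scaler0 addr0.
by rewrite !bext_ten act0.
Qed.

Lemma cindP g : linear (cind g).
Proof. rewrite cind.unlock; exact: mext_is_linear. Qed.

Lemma cind_cten g c e : cind g (cten c e) = tr (act c 1 (g e)).
Proof.
move: c; apply: balg_lin_ext => [d u v|d u v|x].
- by rewrite ctenP cindP.
- by rewrite actPl trP.
by rewrite ctenU cind.unlock mextU.
Qed.

(** This makes [cind g] the map that the bimodule map [bext g] induces on coinvariants. *)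
Lemma tr_bext g m : tr (bext g m) = cind g (tr m).
Proof.
move: m; apply: bimod_ext => [d u v|d u v|x e y].
- by rewrite !(cindP, bextP, trP).
- by rewrite !(cindP, bextP, trP).
by rewrite bext_ten tr_ten cind_cten tr_act.
Qed.

Lemma eq_cind f g : f =1 g -> cind f =1 cind g.
Proof. by move=> e m; rewrite cind.unlock; apply: eq_mext => t; rewrite e. Qed.

Lemma cind_sub f g z : cind (fun e => f e - g e) z = cind f z - cind g z.
Proof.
move: z; apply: coinv_ext => [d u v|d u v|c e].
- by rewrite !cindP.
- by rewrite !cindP scalerBr opprD addrACA.
by rewrite !cind_cten actB trB.
Qed.

End TwoSets.

Lemma bext_id (E : choiceType) (m : F E) : bext (@gen k B E) m = m.
Proof.
move: m; apply: bimod_ext => [d u v|//|x e y].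
- by rewrite bextP.
by rewrite bext_ten act_gen.
Qed.

Lemma cind_id (E : choiceType) (z : C E) : cind (@gen k B E) z = z.
Proof.
move: z; apply: coinv_ext => [d u v|//|c e].
- by rewrite cindP.
by rewrite cind_cten act_gen tr_ten mul1r.
Qed.

Lemma bext_comp (E E' E'' : choiceType) (g : E' -> F E'') (f : E -> F E') m :
  bext g (bext f m) = bext (fun e => bext g (f e)) m.
Proof.
move: m; apply: bimod_ext => [d u v|d u v|x e y].
- by rewrite !bextP.
- by rewrite !bextP.
by rewrite !bext_ten bext_act.
Qed.

Lemma cind_comp (E E' E'' : choiceType) (g : E' -> F E'') (f : E -> F E') z :
  cind g (cind f z) = cind (fun e => bext g (f e)) z.
Proof.
move: z; apply: coinv_ext => [d u v|d u v|c e].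
- by rewrite !cindP.
- by rewrite !cindP.
by rewrite !cind_cten -tr_bext bext_act.
Qed.

End FreeBimodule.

#[global] Opaque balg_mul balg_one.

(** * Comparison of free resolutions *)

Section HomologyDimension.
Variables (k : fieldType) (C : nat -> lmodType k) (d : forall n, C n.+1 -> C n).

Definition cycle (n : nat) : C n -> Prop :=
  match n with 0%N => fun _ => True | m.+1 => fun z => d z = 0 end.
Definition boundary (n : nat) (z : C n) : Prop := exists w, d w = z.

(** As in [HH_dim], the dimension is witnessed by cycles forming a basis modulo boundaries; no
    quotient is formed and d d = 0 is not presupposed. *)
Definition hdim (n r : nat) : Prop :=
  exists zs : 'I_r -> C n,
    [/\ forall i, cycle (zs i),
        forall z, cycle z ->
          exists c : 'I_r -> k, boundary (z - \sum_(i < r) c i *: zs i)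
      & forall c : 'I_r -> k,
          boundary (\sum_(i < r) c i *: zs i) -> forall i, c i = 0].
End HomologyDimension.

(** The images under f of the chosen cycles do the job. Both composites are compared with the
    identity on cycles only and modulo boundaries, so no homotopy operator is required as data. *)
Lemma hdim_equiv (k : fieldType) (C C' : nat -> lmodType k)
    (d : forall n, C n.+1 -> C n) (d' : forall n, C' n.+1 -> C' n)
    (f : forall n, C n -> C' n) (g : forall n, C' n -> C n) :
  (forall n, linear (d n)) -> (forall n, linear (d' n)) ->
  (forall n, linear (f n)) -> (forall n, linear (g n)) ->
  (forall n z, d' n (f n.+1 z) = f n (d n z)) ->
  (forall n z, d n (g n.+1 z) = g n (d' n z)) ->
  (forall n z, cycle d z -> boundary d (z - g n (f n z))) ->
  (forall n z, cycle d' z -> boundary d' (z - f n (g n z))) ->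
  forall n r, hdim d n r -> hdim d' n r.
Proof.
move=> ld ld' lf lg fd gd gf fg n r [zs [zsC zsG zsF]].
have fC m z : cycle d z -> cycle d' (f m z).
  by case: m z => [|m] z //= dz; rewrite fd dz (lin0 (lf m)).
have gC m z : cycle d' z -> cycle d (g m z).
  by case: m z => [|m] z //= dz; rewrite gd dz (lin0 (lg m)).
have cC (c : 'I_r -> k) : cycle d (\sum_(i < r) c i *: zs i).
  case: n zs zsC zsG zsF => [|m] //= zs zsC _ _.
  rewrite (lin_sum (ld m)) big1 // => i _.
  by rewrite (linZ (ld m)) zsC scaler0.
have fS (c : 'I_r -> k) : \sum_(i < r) c i *: f n (zs i) = f n (\sum_(i < r) c i *: zs i).
  rewrite (lin_sum (lf n)); apply: eq_bigr => i _.
  by rewrite (linZ (lf n)).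
exists (fun i => f n (zs i)); split=> [i|z /[dup] zC /gC /zsG[c [w wE]]|c].
- exact: fC.
- have [v vE] := fg _ _ zC.
  exists c, (f n.+1 w + v); rewrite (linD (ld' n)) fd wE vE fS.
  by rewrite (linB (lf n)) addrC addrA subrK.
- rewrite fS => -[w wE]; apply: zsF.
  have [v vE] := gf _ _ (cC c).
  exists (g n.+1 w + v); rewrite (linD (ld n)) gd wE vE.
  by rewrite addrC subrK.
Qed.

HB.lock Definition aug (k : fieldType) (B : basedAlg k) (E : choiceType)
    (m : {malg k[(bkey B * E * bkey B)%type]}) : balg B :=
  mext (fun t => bas t.1.1 * bas t.2) m.

Section Comparison.
Variables (k : fieldType) (B : basedAlg k).
Local Notation A := (balg B).
Local Notation "'F' E" := {malg k[(bkey B * E * bkey B)%type]} (at level 10, E at level 9).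
Local Notation "'C' E" := {malg k[(bkey B * E)%type]} (at level 10, E at level 9).

Lemma augP E : linear (@aug k B E).
Proof. rewrite aug.unlock; exact: mext_is_linear. Qed.
Lemma augB E : {morph (@aug k B E) : m n / m - n}.
Proof. exact: (linB (@augP _)). Qed.
Local Notation ten := (@ten k B _).
Local Notation act := (@act k B _).
Local Notation aug := (@aug k B _).

Lemma aug_ten (E : choiceType) b (e : E) c : aug (ten b e c) = b * c.
Proof.
move: b; apply: balg_lin_ext => [d u v|d u v|x].
- by rewrite tenPl augP.
- by rewrite mulPl.
move: c; apply: balg_lin_ext => [d u v|d u v|y].
- by rewrite tenPr augP.
- by rewrite mulPr.
by rewrite tenU aug.unlock mextU.
Qed.

Lemma aug_act (E : choiceType) b c (m : F E) : aug (act b c m) = b * aug m * c.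
Proof.
move: m; apply: bimod_ext => [d u v|d u v|x e y].
- by rewrite actP augP.
- by rewrite augP mulPr mulPl.
by rewrite act_ten !aug_ten !mulrA.
Qed.

(* The differentials are not assumed to square to zero: this follows from the
   contraction, since every generator lies in its image. *)
Structure resolution := Resolution {
  rgen : nat -> choiceType;
  rbd : forall n, rgen n.+1 -> F (rgen n);
  rctr0 : A -> F (rgen 0%N);
  rctr : forall n, F (rgen n) -> F (rgen n.+1);
  rctr00 : rctr0 0 = 0;
  rctrS0 : forall n, rctr (0 : F (rgen n)) = 0;
  aug_rctr0 : forall c, aug (rctr0 c) = c;
  rctr_htp0 : forall m : F (rgen 0%N), bext (@rbd _) (rctr m) + rctr0 (aug m) = m;
  rctr_htpS : forall n (m : F (rgen n.+1)),
    bext (@rbd _) (rctr m) + rctr (bext (@rbd _) m) = m;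
  rctr_gen : forall n (e : rgen n.+1), exists m, gen B e = rctr m }.

Section OneResolution.
Variable P : resolution.
Local Notation bd := (bext (@rbd P _)).

(** A generator is e = s m, and d s m = m - s0 (aug m) is killed by [aug] because s0 is a section of
    it. *)
Lemma aug_rbd (e : rgen P 1) : aug (rbd e) = 0.
Proof.
have [m mE] := rctr_gen e.
rewrite -[rbd e]bext_gen mE.
have /(canRL (addrK _)) -> := rctr_htp0 m.
by rewrite augB aug_rctr0 subrr.
Qed.

Lemma rbd_rbd_of (n : nat) : (forall e : rgen P n.+2, bd (rbd e) = 0) ->
  forall m : F (rgen P n.+2), bd (bd m) = 0.
Proof. by move=> e0 m; rewrite bext_comp (eq_bext e0) bext_fun0. Qed.

Lemma aug_bd (m : F (rgen P 1)) : aug (bd m) = 0.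
Proof.
move: m; apply: bimod_ext => [d u v|d u v|x e y].
- by rewrite bextP augP.
- by rewrite scaler0 addr0.
by rewrite bext_ten aug_act aug_rbd mulr0 mul0r.
Qed.

(** With e = s m, d d s m = d m - (d s) d m = s d d m, and d d m vanishes by induction. At the
    bottom, the augmentation of d m takes the place of d d m. *)
Lemma rbd_rbd n (e : rgen P n.+2) : bd (rbd e) = 0.
Proof.
elim: n e => [|n IHn] e; have [m mE] := rctr_gen e; rewrite -[rbd e]bext_gen mE.
all: have /(canRL (addrK _)) -> := rctr_htpS m; rewrite bextB.
  have /(canRL (addrK _)) -> := rctr_htp0 (bd m).
  by rewrite aug_bd rctr00 subr0 subrr.
have /(canRL (addrK _)) -> := rctr_htpS (bd m).
by rewrite rbd_rbd_of // rctrS0 subr0 subrr.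
Qed.

Lemma exact0 (m : F (rgen P 0)) : aug m = 0 -> bd (rctr m) = m.
Proof. by move=> m0; rewrite -[RHS](rctr_htp0 m) m0 rctr00 addr0. Qed.

Lemma exactS n (m : F (rgen P n.+1)) : bd m = 0 -> bd (rctr m) = m.
Proof. by move=> m0; rewrite -[RHS](rctr_htpS m) m0 rctrS0 addr0. Qed.

End OneResolution.

Section Lift.
Variables (P Q : resolution) (f0 : rgen P 0 -> rgen Q 0).

(** The contraction of Q chooses a preimage under the differential. Only values on generators are
    chosen, so the contraction need not be a bimodule map. *)
Fixpoint chain_lift n : rgen P n -> F (rgen Q n) :=
  match n return rgen P n -> F (rgen Q n) with
  | 0%N => fun e => gen B (f0 e)
  | n'.+1 => fun e => rctr (bext (@chain_lift n') (rbd e))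
  end.

Lemma aug_chain_lift m : aug (bext (@chain_lift 0) m) = aug m.
Proof.
move: m; apply: bimod_ext => [d u v|d u v|x e y].
- by rewrite bextP augP.
- by rewrite augP.
by rewrite bext_ten act_gen !aug_ten.
Qed.

Lemma rbd_chain_lift n (e : rgen P n.+1) :
  bext (@rbd Q _) (chain_lift e) = bext (@chain_lift n) (rbd e).
Proof.
elim: n e => [|n IHn] e /=.
  by apply: exact0; rewrite aug_chain_lift aug_rbd.
by apply: exactS; rewrite bext_comp (eq_bext IHn) -bext_comp rbd_rbd bext0.
Qed.

End Lift.

Section Homotopy.
Variables (P Q : resolution) (f g : forall n, rgen P n -> F (rgen Q n)).
Hypothesis fbd : forall n (e : rgen P n.+1),
  bext (@rbd Q _) (f e) = bext (@f n) (rbd e).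
Hypothesis gbd : forall n (e : rgen P n.+1),
  bext (@rbd Q _) (g e) = bext (@g n) (rbd e).
Hypothesis fg0 : @f 0 =1 @g 0.

(** The recursion starts from 0 because f and g agree on the generators of degree 0. *)
Fixpoint chain_htp n : rgen P n -> F (rgen Q n.+1) :=
  match n return rgen P n -> F (rgen Q n.+1) with
  | 0%N => fun=> 0
  | n'.+1 => fun e => rctr (f e - g e - bext (@chain_htp n') (rbd e))
  end.

Lemma rbd_chain_htp n (e : rgen P n.+1) :
  bext (@rbd Q _) (chain_htp e) = f e - g e - bext (@chain_htp n) (rbd e).
Proof.
elim: n e => [|n IHn] e /=; apply: exactS; rewrite !bextB fbd gbd.
  by rewrite bext_fun0 bext0 subr0 (eq_bext fg0) subrr.
rewrite [X in _ - X]bext_comp (eq_bext IHn) !bext_sub -bext_comp rbd_rbd.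
by rewrite bext0 subr0 subrr.
Qed.

(** The homotopy extends to a bimodule map, hence descends to coinvariants; its second term drops
    out on cycles. *)
Lemma cind_homotopy n (z : C (rgen P n)) : cycle (fun n => cind (@rbd P n)) z ->
  boundary (fun n => cind (@rbd Q n)) (cind (@f n) z - cind (@g n) z).
Proof.
case: n z => [|n] z /= zC.
  by exists 0; rewrite (lin0 (@cindP _ _ _ _ _)) (eq_cind fg0) subrr.
exists (cind (@chain_htp n.+1) z); rewrite cind_comp (eq_cind (@rbd_chain_htp n)) !cind_sub.
by rewrite -(cind_comp (@chain_htp n)) zC (lin0 (@cindP _ _ _ _ _)) subr0.
Qed.

End Homotopy.

(** The lifts of [f0] and [g0] compose to the identity on generators of degree 0, so the composites
    are homotopic to the identity in all degrees. *)
Lemma hdim_resolution (P Q : resolution) (f0 : rgen P 0 -> rgen Q 0) g0 :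
  cancel f0 g0 -> cancel g0 f0 -> forall n r,
  hdim (fun n => cind (@rbd P n)) n r -> hdim (fun n => cind (@rbd Q n)) n r.
Proof.
move=> fK gK.
have comp (P1 Q1 : resolution) (f1 : rgen P1 0 -> rgen Q1 0) (g1 : rgen Q1 0 -> rgen P1 0) :
    cancel f1 g1 -> forall n z, cycle (fun n => cind (@rbd P1 n)) z ->
    boundary (fun n => cind (@rbd P1 n))
      (z - cind (@chain_lift Q1 P1 g1 n) (cind (@chain_lift P1 Q1 f1 n) z)).
  move=> f1K n z zC; rewrite cind_comp -{1}[z]cind_id.
  apply: (@cind_homotopy P1 P1 (fun n => @gen k B (rgen P1 n))
    (fun n e => bext (@chain_lift Q1 P1 g1 n) (chain_lift f1 e))) => // [m e|m e|e].
  - by rewrite bext_gen bext_id.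
  - by rewrite bext_comp (eq_bext (@rbd_chain_lift _ _ _ _)) -bext_comp rbd_chain_lift bext_comp.
  - by rewrite /= bext_gen /= f1K.
apply: (@hdim_equiv k _ _ _ _ (fun n => cind (@chain_lift P Q f0 n)) (fun n => cind (@chain_lift Q P g0 n))).
- by move=> n; apply: cindP.
- by move=> n; apply: cindP.
- by move=> n; apply: cindP.
- by move=> n; apply: cindP.
- by move=> n z; rewrite !cind_comp; apply: eq_cind => e; apply: rbd_chain_lift.
- by move=> n z; rewrite !cind_comp; apply: eq_cind => e; apply: rbd_chain_lift.
- exact: comp.
- exact: comp.
Qed.

End Comparison.

(** * The bar resolution *)

Section BarResolution.
Variables (k : fieldType) (B : basedAlg k).
Local Notation K := (bkey B).
Local Notation b0 := (bone B).
Local Notation "'F' E" := {malg k[(bkey B * E * bkey B)%type]} (at level 10, E at level 9).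

Lemma eq_from_nth_tuple n (t u : n.-tuple K) :
  (forall j, (j < n)%N -> nth b0 t j = nth b0 u j) -> t = u.
Proof.
by move=> tu; apply: val_inj; apply: (@eq_from_nth _ b0) => [|j];
  rewrite ?size_tuple // => /tu.
Qed.

Lemma nth_mktuple_nat n (f : nat -> K) j : (j < n)%N ->
  nth b0 [tuple f (i : nat) | i < n] j = f j.
Proof. by move=> jn; rewrite (nth_mktuple _ _ (Ordinal jn)). Qed.

Definition bar_cons n (x : K) (t : n.-tuple K) : n.+1.-tuple K := [tuple of x :: t].

(** The indexing is that of [hmerge], so that the faces of the two complexes match literally. *)
Definition bar_merge n (i : nat) (t : n.+1.-tuple K) (b : K) : n.-tuple K :=
  [tuple (if ((j : nat) < i)%N then nth b0 t j
          else if ((j : nat) == i)%N then b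
          else nth b0 t (j : nat).+1) | j < n].

Definition bar_belast n (t : n.+1.-tuple K) : n.-tuple K :=
  [tuple nth b0 t (j : nat) | j < n].

Lemma nth_bar_merge n i (t : n.+1.-tuple K) b j : (j < n)%N ->
  nth b0 (bar_merge i t b) j =
  if (j < i)%N then nth b0 t j else if j == i then b else nth b0 t j.+1.
Proof.
exact: (@nth_mktuple_nat n (fun j => if (j < i)%N then nth b0 t j
  else if j == i then b else nth b0 t j.+1)).
Qed.

Lemma nth_bar_belast n (t : n.+1.-tuple K) j : (j < n)%N ->
  nth b0 (bar_belast t) j = nth b0 t j.
Proof. exact: (@nth_mktuple_nat n (nth b0 t)). Qed.

Definition bar_mid n (i : nat) (t : n.+1.-tuple K) : F (n.-tuple K) :=
  mext (fun b => gen B (bar_merge i t b)) (bmu (nth b0 t i) (nth b0 t i.+1)).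

Definition bar_bd n (t : n.+1.-tuple K) : F (n.-tuple K) :=
  ten (bas (nth b0 t 0)) [tuple of behead t] 1
  + \sum_(i < n) (-1) ^+ i.+1 *: bar_mid i t
  + (-1) ^+ n.+1 *: ten 1 (bar_belast t) (bas (nth b0 t n)).

(** The extra degeneracy, sending b (x) t (x) c to 1 (x) (b, t) (x) c. *)
Definition bar_ctr n (m : F (n.-tuple K)) : F (n.+1.-tuple K) :=
  mext (fun u => ten 1 (bar_cons u.1.1 u.1.2) (bas u.2)) m.

Lemma bar_ctrP n : linear (@bar_ctr n).
Proof. exact: mext_is_linear. Qed.

Lemma bar_ctr_ten n b (t : n.-tuple K) c :
  bar_ctr (ten b t c) = mext (fun x => ten 1 (bar_cons x t) c) b.
Proof.
move: b; apply: balg_lin_ext => [d u v|d u v|x].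
- by rewrite tenPl bar_ctrP.
- by rewrite mext_is_linear.
move: c; apply: balg_lin_ext => [d u v|d u v|y].
- by rewrite tenPr bar_ctrP.
- by rewrite basE !mextU tenPr.
by rewrite tenU /bar_ctr mextU (basE x) mextU.
Qed.

Lemma bar_ctr_tenU n x (t : n.-tuple K) c :
  bar_ctr (ten (bas x) t c) = ten 1 (bar_cons x t) c.
Proof. by rewrite bar_ctr_ten basE mextU. Qed.

Lemma behead_bar_cons n x (t : n.-tuple K) : [tuple of behead (bar_cons x t)] = t.
Proof. exact: val_inj. Qed.

Lemma bar_belast_cons n x (t : n.+1.-tuple K) :
  bar_belast (bar_cons x t) = bar_cons x (bar_belast t).
Proof.
apply: eq_from_nth_tuple => -[|j] jn; rewrite nth_bar_belast //=.
by rewrite nth_bar_belast.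
Qed.

Lemma bar_merge0 n x (t : n.+1.-tuple K) b :
  bar_merge 0 (bar_cons x t) b = bar_cons b [tuple of behead t].
Proof.
apply: eq_from_nth_tuple => -[|j] jn; rewrite nth_bar_merge //=.
by rewrite nth_behead.
Qed.

Lemma bar_mergeS n i x (t : n.+1.-tuple K) b :
  bar_merge i.+1 (bar_cons x t) b = bar_cons x (bar_merge i t b).
Proof.
apply: eq_from_nth_tuple => -[|j] jn; rewrite nth_bar_merge //=.
by rewrite nth_bar_merge // ltnS eqSS.
Qed.

Lemma act_bar_mid0 n x (t : n.+1.-tuple K) c :
  act 1 c (bar_mid 0 (bar_cons x t)) =
  bar_ctr (ten (bas x * bas (nth b0 t 0)) [tuple of behead t] c).
Proof.
rewrite bar_ctr_ten basM (lin_mext _ _ (actP 1 c)).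
by apply: eq_mext => b /=; rewrite act_gen bar_merge0.
Qed.

Lemma act_bar_midS n i x (t : n.+1.-tuple K) c :
  act 1 c (bar_mid i.+1 (bar_cons x t)) = bar_ctr (act (bas x) c (bar_mid i t)).
Proof.
rewrite (lin_mext _ _ (actP 1 c)) (lin_mext _ _ (actP _ c)).
rewrite (lin_mext _ _ (@bar_ctrP _)).
by apply: eq_mext => b /=; rewrite !act_gen bar_ctr_tenU bar_mergeS.
Qed.

Lemma bar_htp0 (m : F (0.-tuple K)) :
  bext (@bar_bd 0) (bar_ctr m) + ten 1 [tuple] (aug m) = m.
Proof.
move: m; apply: bimod_ext => [d u v|//|x e y].
  by rewrite bar_ctrP augP bextP tenPr scalerDr addrACA.
rewrite bar_ctr_tenU bext_ten /bar_bd big_ord0 addr0 expr1 scaleN1r aug_ten.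
rewrite actB !act_ten !mul1r [bar_belast _]tuple0 [X in ten _ X _]tuple0 [e]tuple0.
by rewrite subrK.
Qed.

(** The first face undoes the extra degeneracy. Each later face is the extra degeneracy of the
    preceding face of m with the opposite sign, so all other terms cancel. *)
Lemma bar_htpS n (m : F (n.+1.-tuple K)) :
  bext (@bar_bd n.+1) (bar_ctr m) + bar_ctr (bext (@bar_bd n) m) = m.
Proof.
move: m; apply: bimod_ext => [d u v|//|x t y].
  by rewrite !(bar_ctrP, bextP) scalerDr addrACA.
rewrite bar_ctr_tenU !bext_ten /bar_bd big_ord_recl behead_bar_cons.
rewrite bar_belast_cons !actD !actZ act_bar_mid0 !act_sum !act_ten !mul1r.
rewrite !(linD (@bar_ctrP _)) (linZ (@bar_ctrP _)) (lin_sum (@bar_ctrP _)).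
rewrite mulr1 bar_ctr_tenU /= expr1 scaleN1r.
rewrite (_ : \sum_(i < n) act 1 _ _ = - \sum_(i < n) bar_ctr (act (bas x) (bas y)
    ((-1) ^+ i.+1 *: bar_mid i t))); last first.
  rewrite -sumrN; apply: eq_bigr => i _.
  by rewrite !actZ act_bar_midS (linZ (@bar_ctrP _)) exprS mulN1r scaleNr.
rewrite [(-1) ^+ n.+2]exprS mulN1r scaleNr -opprD -[_ + _ - _ ]addrA -opprD.
by rewrite subrK.
Qed.

Lemma bar_gen n (t : n.+1.-tuple K) : exists m, gen B t = bar_ctr m.
Proof.
exists (ten (bas (thead t)) [tuple of behead t] 1); rewrite gen.unlock bar_ctr_tenU.
by rewrite [t in LHS]tuple_eta.
Qed.

Definition bar_resolution : resolution B.
Proof.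
refine (@Resolution _ _ (fun n => n.-tuple K) bar_bd (fun c => ten 1 [tuple] c)
  bar_ctr _ _ _ bar_htp0 bar_htpS bar_gen).
- exact: (lin0 (tenPr _ _)).
- by move=> n; rewrite (lin0 (@bar_ctrP n)).
- by move=> c; rewrite aug_ten mul1r.
Defined.

End BarResolution.

(** * The generalized Weyl algebra as a ring *)

Section GWABasis.
Variables (k : fieldType) (a : {poly k}) (h0 : k).
Local Notation sg := (sigmaz h0).
Local Notation wc := (wcoef a h0).

Lemma sigmaz0 p : sg 0 p = p.
Proof. by rewrite /sigmaz mul0r subr0 comp_polyXr. Qed.

Lemma sigmazD l m p : sg (l + m) p = sg l (sg m p).
Proof.
rewrite /sigmaz -comp_polyA comp_polyB comp_polyX comp_polyC intrD mulrDl polyCD.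
by rewrite opprD addrA.
Qed.

Lemma sigmazM l : {morph sg l : p q / p * q}.
Proof. by move=> p q; rewrite /sigmaz comp_polyM. Qed.
Lemma sigmaz_add l : {morph sg l : p q / p + q}.
Proof. by move=> p q; rewrite /sigmaz comp_polyD. Qed.
Lemma sigmazZ l c p : sg l (c *: p) = c *: sg l p.
Proof. by rewrite /sigmaz comp_polyZ. Qed.
Lemma sigmazC l c : sg l c%:P = c%:P.
Proof. by rewrite /sigmaz comp_polyC. Qed.
Lemma sigmaz1 l : sg l 1 = 1.
Proof. exact: sigmazC. Qed.
Lemma sigmazP l : linear (sg l).
Proof. by move=> c u v; rewrite sigmaz_add sigmazZ. Qed.
Lemma sigmazX l : sg l 'X = 'X - (l%:~R * h0)%:P.
Proof. by rewrite /sigmaz comp_polyX. Qed.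
Lemma sigmazK l : cancel (sg l) (sg (- l)).
Proof. by move=> p; rewrite -sigmazD addNr sigmaz0. Qed.
Lemma sigmaz_prod l I (r : seq I) (P : pred I) (f : I -> {poly k}) :
  sg l (\prod_(i <- r | P i) f i) = \prod_(i <- r | P i) sg l (f i).
Proof. exact: (big_morph _ (sigmazM l) (sigmaz1 l)). Qed.
Lemma sigmaz_eq0 l p : (sg l p == 0) = (p == 0).
Proof.
apply/eqP/eqP => [e|->]; last exact: sigmazC.
by rewrite -[p](sigmazK l) e; exact: sigmazC.
Qed.

Lemma polyw_coef j (p : {poly k}) i e : (polyw j p)@_((i, e) : gwa_key) = if i == j then p`_e else 0.
Proof.
rewrite /polyw raddf_sum /=; under eq_bigr do rewrite mcoeffU xpair_eqE.
have [_|_] := eqVneq i j; last by rewrite big1.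
have [es|es] := ltnP e (size p).
  rewrite (bigD1 (Ordinal es)) //= eqxx mulr1n big1 ?addr0 // => s /eqP se.
  by case: eqP => // ee; case: se; apply: val_inj.
rewrite nth_default // big1 // => s _; case: eqP => // ee.
by move: es; rewrite -ee leqNgt ltn_ord.
Qed.

Lemma polywP j c (p q : {poly k}) : polyw j (c *: p + q) =
  c *: (polyw j p : {malg k[gwa_key]}) + (polyw j q : {malg k[gwa_key]}).
Proof.
apply/malgP => -[i e]; rewrite mcoeffD mcoeffZ !polyw_coef.
by case: eqP; rewrite ?mulr0 ?addr0 // coefD coefZ.
Qed.

Lemma polyw_Xn j e : polyw j 'X^e = << ((j, e) : gwa_key) >> :> {malg k[gwa_key]}.
Proof.
apply/malgP => -[i e']; rewrite polyw_coef coefXn mcoeffU xpair_eqE.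
by rewrite [j == i]eq_sym [e == e']eq_sym; case: eqP; case: eqP.
Qed.

Lemma mext_polyw (M : lmodType k) (f : gwa_key -> M) (G : {poly k} -> M) j p :
  linear G -> (forall e, f (j, e) = G 'X^e) -> mext f (polyw j p) = G p.
Proof.
move=> lG fG; rewrite -[in RHS](coefK p) poly_def (lin_sum lG) /polyw.
rewrite (lin_sum (@mext_is_linear _ _ _ _)); apply: eq_bigr => e _.
by rewrite mextZU fG (linZ lG).
Qed.

(* In the skew Laurent polynomials k[h][X^(+-1); sigma], with x = X and y = a X^-1,
   the basis element w_j is [wden j] X^j; this makes the associativity of the
   structure constants [wcoef] a cancellation in k[h]. *)
Definition wden (j : int) : {poly k} :=
  if j is Negz m then \prod_(s < m.+1) sg (- (s : nat)%:Z) a else 1.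

Lemma wdenN m : wden (- m%:Z) = \prod_(0 <= s < m) sg (- s%:Z) a.
Proof. by case: m => [|m]; rewrite big_mkord //= big_ord0. Qed.

Lemma wcoef_PN i m : wc i%:Z (- m%:Z) =
  \prod_(0 <= s < minn i m) sg (i%:Z - s%:Z) a.
Proof. by case: m => [|m]; rewrite big_mkord // minn0 big_ord0. Qed.

Lemma wcoef_NP m j : wc (- m%:Z) j%:Z =
  \prod_(0 <= s < minn m j) sg (- ((m - minn m j)%:Z + s%:Z)) a.
Proof. by case: m => [|m]; rewrite big_mkord //= min0n big_ord0. Qed.

Lemma wcoef_NN m n : wc (- m%:Z) (- n%:Z) = 1.
Proof.
case: m n => [|m] [|n] //=; rewrite ?minn0 ?big_ord0 //.
Qed.

Lemma int_absP (i : int) : exists m : nat, i = m%:Z \/ i = - m%:Z.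
Proof. by case: i => m; [exists m; left | exists m.+1; right]. Qed.

(** The coefficient of X^(i+j) in w_i w_j, computed in two ways. For opposite signs, the factors of
    [wden] split into those of the cancelled pairs, which make up [wcoef], and those left over. *)
Lemma wden_wcoef i j : wden i * sg i (wden j) = wc i j * wden (i + j).
Proof.
have wdenP n : wden n%:Z = 1 by [].
case: (int_absP i) (int_absP j) => m [] -> [n [] ->].
- by rewrite -PoszD !wdenP sigmaz1.
- rewrite wdenP mul1r wcoef_PN wdenN sigmaz_prod; under eq_bigr do rewrite -sigmazD.
  have [nm|/ltnW mn] := leqP n m.
    by rewrite subzn // wdenP mulr1.
  rewrite -opprB subzn // wdenN (big_cat_nat (n := m)) //=; congr (_ * _).
  rewrite -{1}[m]add0n big_addn; apply: eq_bigr => s _.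
  by rewrite PoszD opprD addrCA subrr addr0.
- rewrite wdenP sigmaz1 mulr1 wcoef_NP wdenN.
  have [mn|/ltnW nm] := leqP m n.
    rewrite addrC subzn // wdenP mulr1; apply: eq_bigr => s _.
    by rewrite subnn add0r.
  rewrite addrC -opprB subzn // wdenN mulrC (big_cat_nat (n := (m - n)%N)) ?leq_subr //=.
  congr (_ * _); rewrite -{1}[(m - n)%N]add0n big_addn subKn //.
  by apply: eq_bigr => s _; rewrite addrC.
- rewrite wcoef_NN mul1r -opprD -PoszD !wdenN [RHS](big_cat_nat (n := m)) ?leq_addr //=.
  congr (_ * _); rewrite -{2}[m]add0n big_addn addKn sigmaz_prod.
  by apply: eq_bigr => s _; rewrite -sigmazD PoszD opprD addrC.
Qed.

Hypothesis a0 : a != 0.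

Lemma wden_neq0 j : wden j != 0.
Proof.
case: j => m /=; first exact: oner_neq0.
by rewrite prodf_seq_neq0; apply/allP => s _; rewrite sigmaz_eq0.
Qed.

(** Multiplied by the non-zero [wden (i + j + l)], both sides become wden i sigma^i(wden j)
    sigma^(i+j)(wden l), the coefficient of w_i w_j w_l. *)
Lemma wcoefA i j l : wc i j * wc (i + j) l = sg i (wc j l) * wc i (j + l).
Proof.
apply: (mulIf (wden_neq0 (i + j + l))).
rewrite -mulrA -wden_wcoef sigmazD mulrA -wden_wcoef -mulrA -sigmazM wden_wcoef.
by rewrite sigmazM mulrCA wden_wcoef addrA mulrA.
Qed.

Lemma wcoef0l j : wc 0 j = 1.
Proof. by case: j => m //=; rewrite min0n big_ord0. Qed.
Lemma wcoef0r j : wc j 0 = 1.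
Proof. by case: j => m //=; rewrite minn0 big_ord0. Qed.

Lemma bmul1l x : bmul a h0 key0 x = << x >>.
Proof.
case: x => j e; rewrite -[LHS]/(polyw (0 + j) ('X^0 * sg 0 'X^e * wc 0 j)).
rewrite add0r expr0 mul1r wcoef0l mulr1 sigmaz0.
exact: polyw_Xn.
Qed.

Lemma bmul1r x : bmul a h0 x key0 = << x >>.
Proof.
case: x => j e; rewrite -[LHS]/(polyw (j + 0) ('X^e * sg j 'X^0 * wc j 0)).
rewrite addr0 expr0 sigmaz1 wcoef0r !mulr1.
exact: polyw_Xn.
Qed.

Lemma mext_bmull i p j e : mext (fun u => bmul a h0 u (j, e) : {malg k[gwa_key]}) (polyw i p) =
  polyw (i + j) (p * sg i 'X^e * wc i j).
Proof.
apply: (mext_polyw (G := fun p => polyw (i + j) (p * sg i 'X^e * wc i j))) => //.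
move=> c u v /=; rewrite !mulrDl -!scalerAl; exact: polywP.
Qed.

Lemma mext_bmulr i e j q : mext (fun u => bmul a h0 (i, e) u : {malg k[gwa_key]}) (polyw j q) =
  polyw (i + j) ('X^e * sg i q * wc i j).
Proof.
apply: (mext_polyw (G := fun q => polyw (i + j) ('X^e * sg i q * wc i j))) => //.
move=> c u v /=; rewrite sigmazP mulrDr mulrDl -scalerAr -scalerAl; exact: polywP.
Qed.

Lemma bmulA (x y z : gwa_key) :
  mext (fun u => bmul a h0 u z : {malg k[gwa_key]}) (bmul a h0 x y) =
  mext (fun u => bmul a h0 x u : {malg k[gwa_key]}) (bmul a h0 y z).
Proof.
case: x y z => i e [j f] [l g]; rewrite mext_bmull mext_bmulr /= addrA.
congr (polyw _ _).
rewrite !sigmazM -(sigmazD i j) -!mulrA; congr (_ * (_ * _)).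
by rewrite mulrCA wcoefA.
Qed.

Definition gwa_basis : basedAlg k := BasedAlg bmul1l bmul1r bmulA.

End GWABasis.

HB.lock Definition gpw (k : fieldType) (a : {poly k}) (h0 : k) (a0 : a != 0)
  (j : int) (p : {poly k}) : balg (gwa_basis h0 a0) := polyw j p.

HB.lock Definition pol (k : fieldType) (a : {poly k}) (h0 : k) (a0 : a != 0)
  (p : {poly k}) : balg (gwa_basis h0 a0) := gpw h0 a0 0 p.

HB.lock Definition wj (k : fieldType) (a : {poly k}) (h0 : k) (a0 : a != 0)
  (j : int) : balg (gwa_basis h0 a0) := gpw h0 a0 j 1.

Section GWARing.
Variables (k : fieldType) (a : {poly k}) (h0 : k) (a0 : a != 0).
Local Notation sg := (sigmaz h0).
Local Notation wc := (wcoef a h0).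
Local Notation B := (gwa_basis h0 a0).
Local Notation A := (balg B).
Local Notation pw := (gpw h0 a0).

Lemma gpwP j : linear (pw j).
Proof. by move=> c p q; rewrite unlock; exact: polywP. Qed.

Lemma bas_gpw j e : bas ((j, e) : bkey B) = pw j 'X^e.
Proof. by rewrite basE unlock polyw_Xn. Qed.

Lemma poly_lin_ext (M : lmodType k) (f g : {poly k} -> M) : linear f -> linear g ->
  (forall e, f 'X^e = g 'X^e) -> f =1 g.
Proof.
move=> lf lg fg p; rewrite -(coefK p) poly_def (lin_sum lf) (lin_sum lg).
by apply: eq_bigr => e _; rewrite (linZ lf) (linZ lg) fg.
Qed.

Lemma gpwM i p j q : pw i p * pw j q = pw (i + j) (p * sg i q * wc i j).
Proof.
move: p; apply: poly_lin_ext => [c u v|c u v|e].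
- by rewrite gpwP mulPl.
- by rewrite !mulrDl -!scalerAl gpwP.
move: q; apply: poly_lin_ext => [c u v|c u v|f].
- by rewrite gpwP mulPr.
- by rewrite sigmazP mulrDr mulrDl -scalerAr -scalerAl gpwP.
by rewrite -!bas_gpw basM [in RHS]unlock.
Qed.

Local Notation pol := (pol h0 a0).
Local Notation wj := (wj h0 a0).

Lemma polP : linear pol. Proof. by rewrite pol.unlock; apply: gpwP. Qed.
Lemma polM p q : pol (p * q) = pol p * pol q.
Proof. by rewrite pol.unlock gpwM addr0 sigmaz0 wcoef0l mulr1. Qed.
Lemma pol1 : pol 1 = 1.
Proof. by rewrite pol.unlock -(expr0 'X) -bas_gpw. Qed.
Lemma polB p q : pol (p - q) = pol p - pol q.
Proof. exact: (linB polP). Qed.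
Lemma polZ c p : pol (c *: p) = c *: pol p.
Proof. exact: (linZ polP). Qed.
Lemma wj0 : wj 0 = 1. Proof. by move: pol1; rewrite pol.unlock wj.unlock. Qed.
Lemma pol_wj p j : pol p * wj j = pw j p.
Proof. by rewrite pol.unlock wj.unlock gpwM add0r sigmaz1 wcoef0l !mulr1. Qed.
Lemma wj_pol j p : wj j * pol p = pol (sg j p) * wj j.
Proof. by rewrite pol_wj pol.unlock wj.unlock gpwM addr0 mul1r wcoef0r mulr1. Qed.
Lemma wjM i j : wj i * wj j = pol (wc i j) * wj (i + j).
Proof. by rewrite pol_wj wj.unlock gpwM sigmaz1 !mul1r. Qed.

Lemma gwa_lin_ext (M : lmodType k) (f g : A -> M) : linear f -> linear g ->
  (forall p j, f (pol p * wj j) = g (pol p * wj j)) -> f =1 g.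
Proof.
move=> lf lg fg; apply: balg_lin_ext => // -[j e].
by rewrite bas_gpw -pol_wj.
Qed.

End GWARing.

(** * Coinvariants of the bar resolution as Hochschild chains *)

Section BarHochschild.
Variables (k : fieldType) (a : {poly k}) (h0 : k) (a0 : a != 0).
Local Notation B := (gwa_basis h0 a0).
Local Notation K := (bkey B).
Local Notation "'C' E" := {malg k[(bkey B * E)%type]} (at level 10, E at level 9).
Local Notation H n := {malg k[n.+1.-tuple gwa_key]}.

(** The coefficient of a coinvariant becomes slot 0 of the Hochschild chain. *)
Definition hjoin n (z : C (n.-tuple K)) : H n :=
  mext (fun u => << (@bar_cons k B n u.1 u.2 : n.+1.-tuple gwa_key) >>) z.
Definition hsplit n (z : H n) : C (n.-tuple K) :=
  mext (fun t : n.+1.-tuple gwa_key => << ((nth key0 t 0, (behead_tuple t : n.-tuple gwa_key)) : K * n.-tuple K) >>) z.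

Lemma hjoinP n : linear (@hjoin n). Proof. exact: mext_is_linear. Qed.
Lemma hsplitP n : linear (@hsplit n). Proof. exact: mext_is_linear. Qed.

Lemma hsplitK n z : hjoin (@hsplit n z) = z.
Proof.
move: z; apply: malg_lin_ext => [c u v|//|t]; first by rewrite hsplitP hjoinP.
rewrite /hjoin /hsplit !mextU /=; congr << _ >>; apply: val_inj => /=.
by case: t => -[|x t].
Qed.

Lemma hjoinK n z : hsplit (@hjoin n z) = z.
Proof.
move: z; apply: malg_lin_ext => [c u v|//|[x t]]; first by rewrite hjoinP hsplitP.
by rewrite /hjoin /hsplit !mextU /=; congr << (_, _) >>; apply: val_inj.
Qed.

Lemma hbdE n (z : H n.+1) : hbd a h0 z = mext (fun t => hbd_basis a h0 t : H n) z.
Proof. by rewrite mextE. Qed.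

Lemma hjoin_cten n x (t : n.-tuple K) : hjoin (cten (bas x) t) = << (@bar_cons k B n x t : n.+1.-tuple gwa_key) >>.
Proof. by rewrite ctenU /hjoin mextU. Qed.

Lemma mextU_sum (X Y : choiceType) (f : X -> Y) (m : {malg k[X]}) :
  \sum_(b <- msupp m) << m@_b *g f b >> = mext (fun b => << f b >>) m :> {malg k[Y]}.
Proof.
rewrite mextE; apply: eq_bigr => b _.
by rewrite -[LHS]mext_id mextZU.
Qed.

(** The left outer term multiplies into slot 0 and is face 0; the inner faces shift by one; the
    right outer term is carried round by [tr] and is the cyclic face. *)
Lemma hbd_hjoin n z : hbd a h0 (hjoin z) = hjoin (cind (@bar_bd k B n) z).
Proof.
move: z; apply: coinv_bas_ext => [c u v|c u v|x t].
- by rewrite hjoinP !hbdE mext_is_linear.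
- by rewrite cindP hjoinP.
rewrite hjoin_cten hbdE mextU cind_cten /bar_bd !actD act_sum !trD.
rewrite (lin_sum (@trP _ _ _)) !(linD (@hjoinP _)) (lin_sum (@hjoinP _)).
rewrite /hbd_basis big_ord_recl expr0 scale1r.
have joinE' (p : balg B) (u : n.-tuple K) :
    hjoin (cten p u) = mext (fun b => << (@bar_cons k B n b u : n.+1.-tuple gwa_key) >>) p.
  rewrite -{1}[p](@mext_id k K) (lin_mext _ _ (@ctenP _ _ _ _)) (lin_mext _ _ (@hjoinP _)).
  by apply: eq_mext => b; rewrite -hjoin_cten basE.
congr (_ + _ + _).
- rewrite act_ten mul1r tr_ten mul1r basM joinE' /hmerge mextU_sum.
  by apply: eq_mext => b; congr << _ >>; have := @bar_merge0 k B n x t b; rewrite /bar_merge.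
- apply: eq_bigr => i _; rewrite actZ trZ (linZ (@hjoinP _)); congr (_ *: _).
  rewrite /bar_mid (lin_mext _ _ (@actP _ _ _ _ _)) (lin_mext _ _ (@trP _ _ _)) /hmerge mextU_sum.
  rewrite (lin_mext _ _ (@hjoinP _)); apply: eq_mext => b.
  rewrite act_gen tr_ten mul1r hjoin_cten; congr << _ >>; 
  by have := @bar_mergeS k B n i x t b; rewrite /bar_merge.
- rewrite actZ trZ (linZ (@hjoinP _)); congr (_ *: _).
  rewrite act_ten !mulr1 tr_ten basM joinE' /hcyc mextU_sum.
  rewrite (eq_mext (g := fun b => << (@bar_cons k B n b (bar_belast t) : n.+1.-tuple gwa_key) >>)) // => b.
  congr << _ >>; apply: (@eq_from_nth_tuple k B) => j jn.
  rewrite [LHS](@nth_mktuple_nat k B n.+1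
    (fun j => if j == 0%N then b else nth key0 (bar_cons x t) j) j jn).
  by case: j jn => // j jn; rewrite [RHS](@nth_bar_belast k B).
Qed.

Lemma HH_dim_hdim n r : @hdim k (fun n => H n) (@hbd k a h0) n r -> HH_dim a h0 n r.
Proof. by case: n. Qed.

Lemma hdim_bar_HH n r :
  hdim (fun n => cind (@rbd _ _ (bar_resolution B) n)) n r -> HH_dim a h0 n r.
Proof.
move=> bar; apply: HH_dim_hdim; move: n r bar.
apply: (@hdim_equiv k _ _ _ _ (@hjoin) (@hsplit)).
- by move=> n; apply: cindP.
- by move=> n c u v; rewrite !hbdE mext_is_linear.
- exact: hjoinP.
- exact: hsplitP.
- exact: hbd_hjoin.
- by move=> n z; rewrite -[X in hbd _ _ X]hsplitK hbd_hjoin hjoinK.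
- move=> n z _; exists 0; rewrite (lin0 (@cindP _ _ _ _ _)).
  by rewrite hjoinK subrr.
- move=> n z _; exists 0; rewrite hsplitK subrr hbdE.
  exact: (lin0 (@mext_is_linear _ _ _ _)).
Qed.

End BarHochschild.

(** * Twisted derivations D on k[h] with values in a bimodule: D(h) = m and D(pq) = D(p) q +
    sigma^w(p) D(q) *)

HB.lock Definition tder (k : fieldType) (a : {poly k}) (h0 : k) (a0 : a != 0)
    (E : choiceType) (w : int)
    (m : {malg k[(bkey (gwa_basis h0 a0) * E * bkey (gwa_basis h0 a0))%type]})
    (p : {poly k}) : {malg k[(bkey (gwa_basis h0 a0) * E * bkey (gwa_basis h0 a0))%type]} :=
  mext (fun x : gwa_key => \sum_(s < x.2)
    act (pol h0 a0 (sigmaz h0 w 'X^s)) (pol h0 a0 'X^(x.2.-1 - s)) m) (polyw 0 p).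

Section TwistedDerivation.
Variables (k : fieldType) (a : {poly k}) (h0 : k) (a0 : a != 0).
Local Notation sg := (sigmaz h0).
Local Notation B := (gwa_basis h0 a0).
Local Notation pol := (pol h0 a0).
Local Notation wj := (wj h0 a0).
Local Notation "'F' E" := {malg k[(bkey B * E * bkey B)%type]} (at level 10, E at level 9).

Lemma bimod_pol_ext (E : choiceType) (M : lmodType k) (f g : F E -> M) : linear f -> linear g ->
  (forall b e p j, f (ten b e (pol p * wj j)) = g (ten b e (pol p * wj j))) -> f =1 g.
Proof.
move=> lf lg fg; apply: bimod_ext => // x e -[j f'].
by rewrite bas_gpw -pol_wj fg.
Qed.

Variable E : choiceType.

Local Notation tder := (@tder k a h0 a0 E).

Lemma tderP w m : linear (tder w m).
Proof. by move=> c u v; rewrite tder.unlock polywP mext_is_linear. Qed.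

Lemma tder_Xn w m i : tder w m 'X^i =
  \sum_(s < i) act (pol (sg w 'X^s)) (pol 'X^(i.-1 - s)) m.
Proof. by rewrite tder.unlock polyw_Xn mextU. Qed.

Lemma tder1 w m : tder w m 1 = 0.
Proof. by rewrite -(expr0 'X) tder_Xn big_ord0. Qed.

Lemma tderX w m : tder w m 'X = m.
Proof.
by rewrite -(expr1 'X) tder_Xn big_ord1 !expr0 sigmaz1 pol1 act11.
Qed.

Lemma tderM w m p q : tder w m (p * q) =
  act 1 (pol q) (tder w m p) + act (pol (sg w p)) 1 (tder w m q).
Proof.
move: p; apply: poly_lin_ext => [c u v|c u v|i].
- by rewrite mulrDl -scalerAl tderP.
- by rewrite tderP actP sigmazP polP actPl scalerDr addrACA.
move: q; apply: poly_lin_ext => [c u v|c u v|j].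
- by rewrite mulrDr -scalerAr tderP.
- by rewrite tderP actP polP actPr scalerDr addrACA.
rewrite -exprD !tder_Xn !act_sum.
rewrite -(big_mkord xpredT (fun s => act (pol (sg w 'X^s)) (pol 'X^((i + j).-1 - s)) m)).
rewrite (big_cat_nat (n := i)) ?leq_addr //=; congr (_ + _).
  rewrite big_mkord; apply: eq_bigr => s _.
  rewrite act_act mul1r -polM -exprD; congr (act _ (pol 'X^_) _).
  have := ltn_ord s; lia.
rewrite -{1}[i]add0n big_addn addKn big_mkord; apply: eq_bigr => s _.
rewrite act_act mulr1 -polM -sigmazM -exprD [(i + s)%N]addnC.
congr (act _ (pol 'X^_) _).
have := ltn_ord s; lia.
Qed.

Lemma tder_lin w p : linear (fun m => tder w m p).
Proof.
rewrite tder.unlock; apply: mext_fun_is_linear => x c m n; rewrite scaler_sumr -big_split /=.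
by apply: eq_bigr => s _; rewrite actP.
Qed.

(** A twisted derivation is determined by its value at h, and p -> m p - sigma^w(p) m is one, the
    inner one. *)
Lemma tder_comm w m p : tder w (act 1 (pol 'X) m - act (pol (sg w 'X)) 1 m) p =
  act 1 (pol p) m - act (pol (sg w p)) 1 m.
Proof.
move: p; apply: poly_lin_ext => [d u v|d u v|i].
- by rewrite tderP.
- by rewrite polP sigmazP polP actPl actPr scalerBr opprD addrACA.
elim: i => [|i IHi].
  by rewrite expr0 sigmaz1 pol1 tder1 subrr.
rewrite exprS tderM tderX IHi !actB !act_act sigmazM !polM !mul1r !mulr1.
by rewrite addrA subrK.
Qed.

(** Since w_t sigma^(w-t)(q) = sigma^w(q) w_t, a left factor w_t shifts the twist by t. *)
Lemma tder_actl w t m p : tder w (act (wj t) 1 m) p = act (wj t) 1 (tder (w - t) m p).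
Proof.
move: p; apply: poly_lin_ext => [d u v|d u v|i].
- by rewrite tderP.
- by rewrite tderP actP.
rewrite !tder_Xn act_sum; apply: eq_bigr => s _.
by rewrite !act_act mul1r mulr1 wj_pol -sigmazD [t + _]addrC subrK.
Qed.

(** Here w_t stands between m and the right factors q, and w_t q = sigma^t(q) w_t; so the argument
    changes along with the twist. *)
Lemma tder_actr w t m p : tder w (act 1 (wj t) m) p = act 1 (wj t) (tder (w - t) m (sg t p)).
Proof.
move: p; apply: poly_lin_ext => [d u v|d u v|i].
- by rewrite tderP.
- by rewrite sigmazP tderP actP.
(* sigma^t(h) differs from h by a constant, which the derivation kills. *)
have e1 : tder (w - t) m (sg t 'X) = m.
  rewrite sigmazX (linB (tderP _ _)) tderX -[(t%:~R * h0)%:P]mulr1 mul_polyC.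
  by rewrite (linZ (tderP _ _)) tder1 scaler0 subr0.
have e2 : forall i, tder (w - t) m (sg t 'X^i) =
    \sum_(s < i) act (pol (sg w 'X^s)) (pol (sg t 'X^(i.-1 - s))) m.
  elim=> [|j IHj]; first by rewrite expr0 sigmaz1 tder1 big_ord0.
  rewrite exprS sigmazM tderM e1 IHj big_ord_recl /= subn0 expr0 sigmaz1 pol1.
  congr (_ + _); rewrite act_sum; apply: eq_bigr => s _.
  rewrite act_act mulr1 -polM -sigmazD subrK -sigmazM -exprS.
  by rewrite /bump /= add1n -subn1 -subnDA add1n.
rewrite e2 tder_Xn act_sum; apply: eq_bigr => s _.
by rewrite !act_act !mul1r mulr1 wj_pol.
Qed.

End TwistedDerivation.

Lemma bext_tder (k : fieldType) (a : {poly k}) (h0 : k) (a0 : a != 0) (E E' : choiceType)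
    (g : E -> {malg k[(bkey (gwa_basis h0 a0) * E' * bkey (gwa_basis h0 a0))%type]}) w m p :
  bext g (tder w m p) = tder w (bext g m) p.
Proof.
move: p; apply: poly_lin_ext => [d u v|d u v|i].
- by rewrite tderP bextP.
- by rewrite tderP.
rewrite !tder_Xn (lin_sum (@bextP _ _ _ _ _)); apply: eq_bigr => s _.
by rewrite bext_act.
Qed.

(** The pattern of the final cancellation in [actr_htpS]. *)
Lemma zmod_cancel (V : zmodType) (x y1 y2 z1 z2 z3 z4 : V) :
  x - (z1 + z2 + z3 + z4) - (y1 + y2) + z1 + (y1 + z2 + z3 + (y2 + z4)) = x.
Proof.
rewrite -[LHS]addrA.
have -> : z1 + (y1 + z2 + z3 + (y2 + z4)) = (z1 + z2 + z3 + z4) + (y1 + y2).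
  by rewrite (AC (1*(3*2)) ((1*3*4*6)*(2*5))).
by rewrite -[x - _ - _]addrA -opprD subrK.
Qed.

(** * The small resolution *)

Section Words.

(* A word alternating in x and y is encoded by its length and its last letter
   ([true] for x, [false] for y), which is irrelevant for the empty word. *)
Definition wordset (m : nat) : choiceType :=
  if m is 0 then (unit : choiceType) else (bool : choiceType).
Definition word m (r : bool) : wordset m :=
  match m return wordset m with 0%N => tt | _ => r end.
Definition wlast m : wordset m -> bool :=
  match m return wordset m -> bool with 0%N => fun=> true | _ => id end.
Lemma wordK m (q : wordset m) : word m (wlast q) = q.
Proof. by case: m q => [[]|]. Qed.

Definition agen (n : nat) : choiceType :=
  if n is n'.+1 then ((bool + wordset n')%type : choiceType) else (unit : choiceType).
Definition wd n (r : bool) : agen n :=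
  match n return agen n with 0%N => tt | _ => inl r end.
Definition wdh n (r : bool) : agen n.+1 := inr (word n r).

Lemma agenP n (P : agen n.+1 -> Prop) :
  (forall r, P (wd n.+1 r)) -> (forall r, P (wdh n r)) -> forall e, P e.
Proof. by move=> Pw Ph [r|q]; [exact: Pw|rewrite -(wordK q); exact: Ph]. Qed.

Definition wt (r : bool) : int := if r then 1 else -1.
Definition wweight (n : nat) (r : bool) : int := if odd n then wt r else 0.
(* The first letter of the word of length n.+1 ending in r. *)
Definition wfirst (n : nat) (r : bool) : bool := r (+) odd n.

Lemma wtN r : wt (~~ r) = - wt r. Proof. by case: r. Qed.
Lemma wweight_last n r : wweight n (~~ r) = wweight n.+1 r - wt r.
Proof. by rewrite /wweight /= wtN; case: (odd n) => /=; rewrite ?sub0r ?subrr. Qed.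
Lemma wweight_first n r : wweight n r = wweight n.+1 r - wt (wfirst n r).
Proof. by rewrite /wweight /wfirst /=; case: (odd n); case: r. Qed.
Lemma wfirstS n r : wfirst n.+1 (~~ r) = wfirst n r.
Proof. by rewrite /wfirst /=; case: (odd n); case: r. Qed.

(** In the first case the letter r extends w_j on the left; in the second it meets its opposite and
    r w_j reduces. *)
Lemma wtP (r : bool) (j : int) :
  (exists m : nat, j = wt r * m%:Z) \/ (exists m : nat, j = wt (~~ r) * m.+1%:Z).
Proof.
case: r; case: j => m.
- by left; exists m; rewrite mul1r.
- by right; exists m; rewrite mulN1r NegzE.
- case: m => [|m]; first by left; exists 0%N; rewrite mulr0.
  by right; exists m; rewrite mul1r.
- by left; exists m.+1; rewrite mulN1r NegzE.
Qed.

End Words.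

HB.lock Definition letter (k : fieldType) (a : {poly k}) (h0 : k) (a0 : a != 0)
  (r : bool) : balg (gwa_basis h0 a0) := wj h0 a0 (wt r).

Section Resolution.
Variables (k : fieldType) (a : {poly k}) (h0 : k) (a0 : a != 0).
Local Notation sg := (sigmaz h0).
Local Notation wc := (wcoef a h0).
Local Notation B := (gwa_basis h0 a0).
Local Notation A := (balg B).
Local Notation pol := (pol h0 a0).
Local Notation wj := (wj h0 a0).
Local Notation "'F' E" := {malg k[(bkey B * E * bkey B)%type]} (at level 10, E at level 9).

Local Notation letter := (letter h0 a0).
Lemma letterE r : letter r = wj (wt r). Proof. by rewrite letter.unlock. Qed.
(** The last two letters of a word ending in r multiply to [lprod (~~ r)]. *)
Definition lprod (r : bool) : {poly k} := wc (wt r) (wt (~~ r)).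

Lemma lprodN r : lprod (~~ r) = wc (wt (~~ r)) (wt r).
Proof. by rewrite /lprod negbK. Qed.

Lemma letter_pol r p : letter r * pol p = pol (sg (wt r) p) * letter r.
Proof. by rewrite letterE wj_pol. Qed.

Lemma letter_wj r j : letter r * wj j = pol (wc (wt r) j) * wj (wt r + j).
Proof. by rewrite letterE wjM. Qed.

Lemma wcoef_same r m : wc (wt r) (wt r * m%:Z) = 1.
Proof.
by case: r; rewrite ?mul1r // mulN1r /wt -[-1]/(- 1%:Z) wcoef_NN.
Qed.

Lemma wcoef_opp r m : wc (wt r) (wt (~~ r) * m.+1%:Z) = lprod r.
Proof.
have PN n : wc 1%:Z (- n.+1%:Z) = sg 1 a.
  by rewrite wcoef_PN (minn_idPl _) // big_mkord big_ord1 subr0.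
have NP n : wc (- 1%:Z) n.+1%:Z = sg 0 a.
  by rewrite wcoef_NP (minn_idPl _) // big_mkord big_ord1.
rewrite /lprod; case: r.
  have -> : wt (~~ true) * m.+1%:Z = - m.+1%:Z by rewrite mulN1r.
  exact: etrans (PN m) (esym (PN 0%N)).
have -> : wt (~~ false) * m.+1%:Z = m.+1%:Z by rewrite mul1r.
exact: etrans (NP m) (esym (NP 0%N)).
Qed.

Lemma letter_same r m : letter r * wj (wt r * m%:Z) = wj (wt r * m.+1%:Z).
Proof.
by rewrite !letterE wjM wcoef_same pol1 mul1r -[m.+1]addn1 PoszD mulrDr mulr1 addrC.
Qed.

Lemma letter_opp r : letter r * letter (~~ r) = pol (lprod r).
Proof. by rewrite !letterE wjM wtN subrr wj0 mulr1 /lprod wtN. Qed.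

Lemma lprod_true : lprod true = sg 1 a.
Proof. by rewrite /lprod /= big_ord1 subr0. Qed.
Lemma lprod_false : lprod false = a.
Proof. by rewrite /lprod /= big_ord1 sigmaz0. Qed.

(* For a word u = l u' = u'' r of length m, the differential is
     d[u]  = [u'']r + (-1)^m l[u'] - D_v(p),
     d[uh] = [u]h - sigma^w(h)[u] - [u''h]r - (-1)^m l[u'h],
   where w is the weight of u, v is u without its last two letters, p in k[h] is
   the product of these two letters, and D_v is the twisted derivation
   k[h] -> P with D_v(h) = [vh].  The terms with u', u'' (resp. v) are absent when
   u is empty (resp. has length at most 1). *)
Definition arel n (r : bool) : F (agen n) :=
  ten 1 (wd n (~~ r)) (letter r) + (-1) ^+ n.+1 *: ten (letter (wfirst n r)) (wd n r) 1.
Definition arelh n (r : bool) : F (agen n.+1) :=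
  ten 1 (wdh n (~~ r)) (letter r) + (-1) ^+ n.+1 *: ten (letter (wfirst n r)) (wdh n r) 1.
Definition wder n (r : bool) p : F (agen n.+1) :=
  tder (wweight n r) (gen B (wdh n r)) p.

Definition acorr n (r : bool) : F (agen n) :=
  match n return F (agen n) with 0%N => 0 | n'.+1 => wder n' r (lprod (~~ r)) end.
Definition arelh_pred n (r : bool) : F (agen n) :=
  match n return F (agen n) with 0%N => 0 | n'.+1 => arelh n' r end.
Definition acomm n (r : bool) : F (agen n) :=
  act 1 (pol 'X) (gen B (wd n r)) - act (pol (sg (wweight n r) 'X)) 1 (gen B (wd n r)).

Definition abd n (e : agen n.+1) : F (agen n) :=
  match e with
  | inl r => arel n r - acorr n r
  | inr q => acomm n (wlast q) - arelh_pred n (wlast q)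
  end.

Lemma abd_wd n r : abd (wd n.+1 r) = arel n r - acorr n r.
Proof. by []. Qed.
Lemma abd_wdh n r : abd (wdh n r) = acomm n r - arelh_pred n r.
Proof. by case: n. Qed.

Fixpoint ctr_rec (r : bool) (m : nat) : F (agen 1) :=
  if m is m'.+1 then
    ten 1 (wd 1 r) (wj (wt r * m'%:Z)) + act (letter r) 1 (ctr_rec r m')
  else 0.

(** The value s([u] w_j) for u of length n ending in r. For n > 0 the test says that w_j begins with
    the letter other than r, which can then be appended to u. *)
Definition ctr_wj n (r : bool) (j : int) : F (agen n.+1) :=
  match n return F (agen n.+1) with
  | 0%N => ctr_rec (0 <= j) `|j|%N
  | n'.+1 => if 0 < wt (~~ r) * j
             then ten 1 (wd n'.+2 (~~ r)) (wj (j - wt (~~ r))) else 0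
  end.

Lemma ctr_wj0 r r' m : ctr_wj 0 r' (wt r * m%:Z) = ctr_rec r m.
Proof.
case: m => [|m]; first by rewrite mulr0.
by rewrite /ctr_wj; case: r; rewrite ?mul1r ?mulN1r.
Qed.

Lemma ctr_wj_same n r m : ctr_wj n.+1 r (wt r * m%:Z) = 0.
Proof. by case: r; rewrite /ctr_wj /= ?mul1r ?mulN1r ?opprK; case: m. Qed.

Lemma ctr_wj_opp n r m :
  ctr_wj n.+1 r (wt (~~ r) * m.+1%:Z) = ten 1 (wd n.+2 (~~ r)) (wj (wt (~~ r) * m%:Z)).
Proof.
rewrite /ctr_wj ifT.
  by congr (ten _ _ (wj _)); rewrite -[m.+1]addn1 PoszD mulrDr mulr1 addrK.
by case: r; rewrite /wt /= ?mul1r // mulN1r mulN1r opprK.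
Qed.

Definition ctr_word n (r : bool) (c : A) : F (agen n.+1) :=
  mext (fun x : gwa_key => act 1 (wj x.1) (wder n r 'X^(x.2)) +
    act (pol (sg (wweight n r) 'X^(x.2))) 1 (ctr_wj n r x.1)) c.

Lemma ctr_wordP n r : linear (ctr_word n r).
Proof. exact: mext_is_linear. Qed.

Lemma ctr_wordE n r p j : ctr_word n r (pol p * wj j) =
  act 1 (wj j) (wder n r p) + act (pol (sg (wweight n r) p)) 1 (ctr_wj n r j).
Proof.
move: p; apply: poly_lin_ext => [c u v|c u v|e].
- by rewrite polP mulPl ctr_wordP.
- by rewrite /wder tderP actP sigmazP polP actPl scalerDr addrACA.
by rewrite pol_wj -bas_gpw basE /ctr_word mextU.
Qed.

Definition ctr_gen n : agen n -> A -> F (agen n.+1) :=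
  match n return agen n -> A -> F (agen n.+1) with
  | 0%N => fun=> ctr_word 0 true
  | n'.+1 => fun e c => if e is inl r then ctr_word n'.+1 r c else 0
  end.

Lemma ctr_genP n e : linear (@ctr_gen n e).
Proof.
move=> c u v; case: n e => [[]|n [r|q]]; [exact: ctr_wordP|exact: ctr_wordP|].
by rewrite /= scaler0 addr0.
Qed.

Lemma ctr_gen_wd n r : ctr_gen (wd n r) = ctr_word n r.
Proof. by case: n => //; case: r. Qed.
Lemma ctr_gen_wdh n r c : ctr_gen (wdh n r) c = 0.
Proof. by []. Qed.

(* The contraction s is left A-linear, kills [uh] c, and sends [u] p w_j to
   D_u(p) w_j + sigma^w(p) s([u] w_j).  For u nonempty, s([u] w_j) is [uz] w_i if
   w_j = z w_i with uz alternating, and 0 otherwise; for u empty, s([] x^j) is the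
   sum of the x^i [x] x^(j-1-i), and likewise for y. *)
Definition actr n (m : F (agen n)) : F (agen n.+1) :=
  mext (fun t => act (bas t.1.1) 1 (ctr_gen t.1.2 (bas t.2))) m.

Lemma actrP n : linear (@actr n).
Proof. exact: mext_is_linear. Qed.

Lemma actr_ten n b (e : agen n) c : actr (ten b e c) = act b 1 (ctr_gen e c).
Proof.
move: b; apply: balg_lin_ext => [d u v|d u v|x].
- by rewrite tenPl actrP.
- by rewrite actPl.
move: c; apply: balg_lin_ext => [d u v|d u v|y].
- by rewrite tenPr actrP.
- by rewrite ctr_genP actP.
by rewrite tenU /actr mextU.
Qed.

Lemma actr_act n b m : actr (act b 1 m) = act b 1 (actr m : F (agen n.+1)).
Proof.
move: m; apply: bimod_ext => [d u v|d u v|x e y].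
- by rewrite actP actrP.
- by rewrite actrP actP.
by rewrite act_ten mulr1 !actr_ten act_act mulr1.
Qed.

Lemma actr_act_wdh n b c b' c' r : actr (act b c (ten b' (wdh n r) c')) = 0.
Proof. by rewrite act_ten actr_ten ctr_gen_wdh act0. Qed.

Lemma actr_tder_wdh n b c w r p : actr (act b c (tder w (gen B (wdh n r)) p)) = 0.
Proof.
move: p; apply: poly_lin_ext => [d u v|d u v|i].
- by rewrite tderP actP actrP.
- by rewrite scaler0 addr0.
rewrite tder_Xn act_sum (lin_sum (@actrP _)) big1 // => s _.
by rewrite act_act act_gen actr_ten ctr_gen_wdh act0.
Qed.

(** The boundaries d[x] = []x - x[] telescope along the sum, and likewise for y. *)
Lemma bext_abd_ctr_rec r m : bext (@abd 0) (ctr_rec r m) =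
  ten 1 (wd 0 r) (wj (wt r * m%:Z)) - ten (wj (wt r * m%:Z)) (wd 0 r) 1.
Proof.
elim: m => [|m IHm]; first by rewrite mulr0 wj0 subrr bext0.
rewrite /= bextD bext_act IHm bext_ten -/(wd 1 r) abd_wd /arel /acorr subr0.
rewrite expr1 scaleN1r /wfirst addbF !actB !act_ten !mul1r !mulr1 !letter_same.
by rewrite addrA subrK.
Qed.

(** A bimodule map carries D_u to the twisted derivation with value d[uh] at h, and the commutator
    part of d[uh] gives an inner one. *)
Lemma bext_abd_wder n r p : bext (@abd n) (wder n r p) =
  act 1 (pol p) (gen B (wd n r)) - act (pol (sg (wweight n r) p)) 1 (gen B (wd n r))
  - tder (wweight n r) (arelh_pred n r) p.
Proof.
rewrite /wder bext_tder bext_gen abd_wdh (linB (@tder_lin _ _ _ _ _ _ _)).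
by rewrite tder_comm.
Qed.

Lemma tder_arelh n r p : tder (wweight n.+1 r) (arelh n r) p =
  act 1 (letter r) (wder n (~~ r) (sg (wt r) p)) +
  (-1) ^+ n.+1 *: act (letter (wfirst n r)) 1 (wder n r p).
Proof.
have -> : arelh n r = act 1 (letter r) (gen B (wdh n (~~ r))) +
    (-1) ^+ n.+1 *: act (letter (wfirst n r)) 1 (gen B (wdh n r)).
  by rewrite !act_gen.
rewrite (linD (@tder_lin _ _ _ _ _ _ _)) (linZ (@tder_lin _ _ _ _ _ _ _)).
rewrite !letterE tder_actr tder_actl.
by rewrite -wweight_last -wweight_first.
Qed.

Definition actr0 (c : A) : F (agen 0) := ten c (wd 0 true) 1.

Lemma actr_htp0 (m : F (agen 0)) : bext (@abd 0) (actr m) + actr0 (aug m) = m.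
Proof.
move: m; apply: bimod_pol_ext => [d u v|//|b [] p j].
  by rewrite actrP augP bextP /actr0 tenPl scalerDr addrACA.
rewrite actr_ten bext_act /actr0 aug_ten -/(wd 0 true) ctr_gen_wd ctr_wordE bextD.
rewrite !bext_act bext_abd_wder /= (lin0 (@tder_lin _ _ _ _ _ _ _)) subr0 sigmaz0.
have -> : bext (@abd 0) (ctr_wj 0 true j) = ten 1 (wd 0 true) (wj j) - ten (wj j) (wd 0 true) 1.
  by case: (wtP true j) => -[m ->]; rewrite ctr_wj0 bext_abd_ctr_rec.
rewrite !actB !act_act !act_ten !mul1r !mulr1.
by rewrite !act_gen addrA subrK actB !act_ten !mulr1 subrK.
Qed.

Lemma actr_arel n r c : actr (act 1 c (arel n r)) =
  ctr_word n (~~ r) (letter r * c) +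
  (-1) ^+ n.+1 *: act (letter (wfirst n r)) 1 (ctr_word n r c).
Proof.
rewrite actD actZ !act_ten !mul1r (linD (@actrP _)) (linZ (@actrP _)) !actr_ten.
by rewrite !ctr_gen_wd act11.
Qed.

Lemma actr_acorr n r c : actr (act 1 c (acorr n r)) = 0.
Proof.
case: n => [|n]; last exact: actr_tder_wdh.
by rewrite act0 (lin0 (@actrP _)).
Qed.

Lemma actr_arelh_pred n r c : actr (act 1 c (arelh_pred n r)) = 0.
Proof.
case: n => [|n] /=; first by rewrite act0 (lin0 (@actrP _)).
by rewrite actD actZ (linD (@actrP _)) (linZ (@actrP _)) !actr_act_wdh scaler0 addr0.
Qed.

(** The contraction identity on [u] w_j, for u = u'' r = l u' of length n+1: the first term is d
    s([u] w_j), the next two are s([u''] r w_j), the last is (-1)^(n+1) l s([u'] w_j). If r extends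
    w_j, then s([u''] r w_j) yields [u] w_j. Otherwise w_j = z w_i, and [u] w_j is the leading term
    of d[uz] w_i, whose derivation term cancels the second term and whose term in [u'z] cancels
    against the last. For n = 0 the further summands of s on the empty word cancel too. *)
Lemma ctr_wj_id n r j :
  bext (@abd n.+1) (ctr_wj n.+1 r j) +
  act 1 (wj (wt r + j)) (wder n (~~ r) (wc (wt r) j)) +
  act (pol (sg (wweight n (~~ r)) (wc (wt r) j))) 1 (ctr_wj n (~~ r) (wt r + j)) +
  (-1) ^+ n.+1 *: act (letter (wfirst n r)) 1 (ctr_wj n r j) =
  ten 1 (wd n.+1 r) (wj j).
Proof.
case: (wtP r j) => -[m ->].
  rewrite wcoef_same sigmaz1 pol1 act11 ctr_wj_same bext0 add0r /wder tder1 act0 add0r.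
  have -> : wt r + wt r * m%:Z = wt r * m.+1%:Z.
    by rewrite -[m.+1]addn1 PoszD mulrDr mulr1 addrC.
  case: n => [|n].
    by rewrite !ctr_wj0 expr1 scaleN1r /wfirst addbF /= addrK.
  rewrite ctr_wj_same act0 scaler0 addr0.
  by have := ctr_wj_opp n (~~ r) m; rewrite negbK.
rewrite wcoef_opp ctr_wj_opp.
have -> : wt r + wt (~~ r) * m.+1%:Z = wt (~~ r) * m%:Z.
  by rewrite -[m.+1]addn1 PoszD mulrDr mulr1 addrCA wtN subrr addr0.
rewrite bext_ten abd_wd /arel /acorr /= negbK actB actD actZ !act_ten !mul1r.
rewrite letter_same wfirstS subrK -/(wd n.+1 r) exprS mulN1r scaleNr.
case: n => [|n].
  rewrite !ctr_wj0 /= expr1 !scaleN1r opprK /wfirst addbF actD act_ten act_act.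
  rewrite mulr1 mul1r letter_opp sigmaz0.
  by rewrite mulr1 -[X in X - _]addrA addrK.
rewrite ctr_wj_same act0 addr0 ctr_wj_opp act_ten !mulr1 -/(wd n.+2 (~~ r)).
by rewrite subrK.
Qed.

Lemma actr_htpS n (m : F (agen n.+1)) :
  bext (@abd n.+1) (actr m) + actr (bext (@abd n) m) = m.
Proof.
move: m; apply: bimod_pol_ext => [d u v|//|b + p j].
  by rewrite !(actrP, bextP) scalerDr addrACA.
(* The differential and the contraction are left A-linear, so b = 1 suffices. *)
have reduce (e : agen n.+1) c :
  bext (@abd n.+1) (ctr_gen e c) + actr (act 1 c (abd e)) = ten 1 e c ->
  bext (@abd n.+1) (actr (ten b e c)) + actr (bext (@abd n) (ten b e c)) = ten b e c.
  move=> ec; rewrite actr_ten bext_act bext_ten.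
  have -> : act b c (abd e) = act b 1 (act 1 c (abd e)) by rewrite act_act !mulr1.
  by rewrite actr_act -actD ec act_ten !mulr1.
apply: agenP => r; apply: reduce.
  rewrite ctr_gen_wd ctr_wordE abd_wd actB (linB (@actrP _)) actr_acorr subr0.
  rewrite actr_arel bextD !bext_act bext_abd_wder mulrA letter_pol -mulrA.
  rewrite letter_wj mulrA -polM !ctr_wordE.
  set q := sg (wweight n.+1 r) p.
  have qE : sg (wweight n (~~ r)) (sg (wt r) p) = q.
    by rewrite -sigmazD wweight_last subrK.
  have qF : letter (wfirst n r) * pol (sg (wweight n r) p) = pol q * letter (wfirst n r).
    by rewrite letter_pol -sigmazD wweight_first addrC subrK.
  (* The identity for w_j is multiplied by sigma^w(p), with w the weight of u. *)
  have := congr1 (act (pol q) 1) (ctr_wj_id n r j).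
  rewrite act_ten !actD actZ mulr1 !act_act !mulr1 ?mul1r -polM -qE -sigmazM qE => key.
  (* The Leibniz rule separates p from the structure constant of r w_j. *)
  rewrite {1}/wder tderM -/(wder n (~~ r) _) -/(wder n (~~ r) _) qE.
  rewrite [arelh_pred n.+1 r]/= tder_arelh.
  rewrite !(actN, actD, actZ, act_act) ?mulr1 ?mul1r qF.
  rewrite !act_gen -letter_wj.
  rewrite -key !scalerDr.
  exact: zmod_cancel.
(* On [uh] c only s([u] h c - sigma^w(h) [u] c) contributes, and the Leibniz rule for D_u(hp) leaves
   D_u(h) p = [uh] p. *)
rewrite ctr_gen_wdh bext0 add0r abd_wdh actB (linB (@actrP _)) actr_arelh_pred subr0.
rewrite /acomm actB (linB (@actrP _)) !act_act !mul1r ?mulr1 !act_gen !actr_ten.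
rewrite ctr_gen_wd act11 mulrA -polM !ctr_wordE /wder tderM tderX sigmazM polM.
rewrite !actD !act_act !mul1r ?mulr1 act_gen -!addrA.
by rewrite [X in _ + X]addrA subrr addr0.
Qed.

(** Namely [u] = s([u''] r) for u = u'' r, and [uh] = s([u] h). *)
Lemma actr_gen n (e : agen n.+1) : exists m, gen B e = actr m.
Proof.
move: e; apply: agenP => r.
  exists (ten 1 (wd n (~~ r)) (letter r)).
  rewrite actr_ten act11 ctr_gen_wd letterE -[wj _]mul1r -pol1 ctr_wordE /wder tder1.
  rewrite act0 add0r sigmaz1 pol1 act11 gen.unlock.
  have -> : wt r = wt r * 1%:Z by rewrite mulr1.
  case: n => [|n]; last first.
    by have := ctr_wj_opp n (~~ r) 0; rewrite negbK mulr0 wj0 => ->.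
  by rewrite ctr_wj0 /= act0 addr0 mulr0 wj0.
exists (ten 1 (wd n r) (pol 'X)).
rewrite actr_ten act11 ctr_gen_wd -[pol _]mulr1 -wj0 ctr_wordE wj0 act11 /wder tderX.
have -> : (0 : int) = wt r * 0%:Z by rewrite mulr0.
by case: n => [|n]; rewrite ?ctr_wj0 ?ctr_wj_same /= act0 addr0.
Qed.

Definition gwa_resolution : resolution B.
Proof.
refine (@Resolution _ _ agen abd actr0 actr _ _ _ actr_htp0 actr_htpS actr_gen).
- exact: (lin0 (tenPl _ _)).
- by move=> n; rewrite (lin0 (@actrP n)).
- by move=> c; rewrite aug_ten mulr1.
Defined.

End Resolution.

#[global] Arguments agen : simpl never.

(** * Reduction to weight zero *)

(** Here w is the weight of the generator that carries c, so that j + w is the total weight. *)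
HB.lock Definition wproj (k : fieldType) (a : {poly k}) (h0 : k) (a0 : a != 0)
    (w : int) (c : balg (gwa_basis h0 a0)) : balg (gwa_basis h0 a0) :=
  mext (fun x : gwa_key => if x.1 + w == 0 then bas (x : bkey (gwa_basis h0 a0)) else 0) c.

(** Inverse of the commutator with h on non-zero total weight. At total weight 0 the scalar is 0,
    and so is its inverse by convention. *)
HB.lock Definition winv (k : fieldType) (a : {poly k}) (h0 : k) (a0 : a != 0)
    (w : int) (c : balg (gwa_basis h0 a0)) : balg (gwa_basis h0 a0) :=
  mext (fun x : gwa_key => ((x.1 + w)%:~R * h0)^-1 *: bas (x : bkey (gwa_basis h0 a0))) c.

HB.lock Definition wcoord (k : fieldType) (a : {poly k}) (h0 : k) (a0 : a != 0)
    (w : int) (c : balg (gwa_basis h0 a0)) : {poly k} :=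
  mext (fun x : gwa_key => if x.1 + w == 0 then 'X^(x.2) else 0) c.

Section Weights.
Variables (k : fieldType) (a : {poly k}) (h0 : k) (a0 : a != 0).
Hypothesis chark : [pchar k] =i pred0.
Hypothesis h00 : h0 != 0.
Local Notation sg := (sigmaz h0).
Local Notation B := (gwa_basis h0 a0).
Local Notation A := (balg B).
Local Notation pol := (pol h0 a0).
Local Notation wj := (wj h0 a0).
Local Notation letter := (letter h0 a0).
Local Notation lprod := (lprod a h0).
Local Notation wproj := (@wproj k a h0 a0).
Local Notation winv := (@winv k a h0 a0).
Local Notation wcoord := (@wcoord k a h0 a0).
Local Notation abd := (@abd k a h0 a0 _).
Local Notation "'C' E" := {malg k[(bkey B * E)%type]} (at level 10, E at level 9).

Lemma wprojP w : linear (wproj w).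
Proof. rewrite wproj.unlock; exact: mext_is_linear. Qed.
Lemma winvP w : linear (winv w).
Proof. rewrite winv.unlock; exact: mext_is_linear. Qed.
Lemma wcoordP w : linear (wcoord w).
Proof. rewrite wcoord.unlock; exact: mext_is_linear. Qed.

Lemma wprojE w p j : wproj w (pol p * wj j) = if j + w == 0 then pol p * wj j else 0.
Proof.
move: p; apply: poly_lin_ext => [c u v|c u v|e].
- by rewrite polP mulPl wprojP.
- by rewrite polP mulPl; case: ifP; rewrite ?scaler0 ?addr0.
by rewrite pol_wj -bas_gpw wproj.unlock {1}basE mextU.
Qed.

Lemma winvE w p j : winv w (pol p * wj j) = ((j + w)%:~R * h0)^-1 *: (pol p * wj j).
Proof.
move: p; apply: poly_lin_ext => [c u v|c u v|e].
- by rewrite polP mulPl winvP.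
- by rewrite polP mulPl scalerDr !scalerA mulrC.
by rewrite pol_wj -bas_gpw winv.unlock {1}basE mextU.
Qed.

Lemma wcoordE w p j : wcoord w (pol p * wj j) = if j + w == 0 then p else 0.
Proof.
move: p; apply: poly_lin_ext => [c u v|c u v|e].
- by rewrite polP mulPl wcoordP.
- by case: ifP; rewrite ?scaler0 ?addr0.
by rewrite pol_wj -bas_gpw wcoord.unlock {1}basE mextU.
Qed.

Lemma wcoord_wproj w c : wcoord w (wproj w c) = wcoord w c.
Proof.
move: c; apply: gwa_lin_ext => [d u v|d u v|p j].
- by rewrite wprojP wcoordP.
- by rewrite wcoordP.
rewrite wprojE wcoordE; case: ifP => jw; first by rewrite wcoordE jw.
exact: (lin0 (wcoordP _)).
Qed.

Lemma wprojEcoord w c : wproj w c = pol (wcoord w c) * wj (- w).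
Proof.
move: c; apply: gwa_lin_ext => [d u v|d u v|p j].
- by rewrite wprojP.
- by rewrite wcoordP polP mulPl.
rewrite wprojE wcoordE; case: ifP => [/eqP jw|jw].
  by rewrite -[j](addrK w) jw sub0r.
by rewrite (lin0 (polP _ _)) mul0r.
Qed.

Lemma intr_neq0 (z : int) : (z%:~R * h0 == 0) = (z == 0).
Proof.
rewrite mulf_eq0 (negbTE h00) orbF.
have nat_eq0 := (pcharf0P _).1 chark.
case: z => n; first by rewrite nat_eq0.
by rewrite NegzE rmorphN /= oppr_eq0 nat_eq0.
Qed.

Definition wcomm w (c : A) : A := pol 'X * c - c * pol (sg w 'X).

Lemma wcommP w : linear (wcomm w).
Proof. by move=> d u v; rewrite /wcomm mulPl mulPr scalerBr opprD addrACA. Qed.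

(* The commutator with h acts on the component of total weight j + w as a scalar,
   invertible unless j + w = 0. *)
Lemma wcommE w p j : wcomm w (pol p * wj j) = ((j + w)%:~R * h0) *: (pol p * wj j).
Proof.
rewrite /wcomm mulrA -polM -[X in _ - X]mulrA wj_pol mulrA -polM -mulrBl -polB.
rewrite -sigmazD sigmazX mulrBr [p * 'X]mulrC opprB addrCA subrr addr0.
by rewrite mulrC mul_polyC polZ scalerAl.
Qed.

Lemma winv_wcomm w c : winv w (wcomm w c) = c - wproj w c.
Proof.
move: c; apply: gwa_lin_ext => [d u v|d u v|p j].
- by rewrite wcommP winvP.
- by rewrite wprojP scalerBr opprD addrACA.
rewrite wcommE (linZ (winvP _)) winvE wprojE scalerA.
case: ifP => [jw|/negbT jw]; last by rewrite divff ?intr_neq0 // scale1r subr0.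
by rewrite (eqP jw) mul0r mul0r scale0r subrr.
Qed.

Lemma wcomm_winv w c : wcomm w (winv w c) = c - wproj w c.
Proof.
rewrite -winv_wcomm; move: c; apply: gwa_lin_ext => [d u v|d u v|p j].
- by rewrite winvP wcommP.
- by rewrite wcommP winvP.
by rewrite winvE (linZ (wcommP _)) wcommE (linZ (winvP _)) winvE !scalerA mulrC.
Qed.

(** Total weight is preserved when a letter passes from the generator to its coefficient, so the
    same scalar is inverted on both sides. *)
Lemma winv_letterl n r c :
  winv (wweight n (~~ r)) (letter r * c) = letter r * winv (wweight n.+1 r) c.
Proof.
move: c; apply: gwa_lin_ext => [d u v|d u v|p j].
- by rewrite mulPr winvP.
- by rewrite winvP mulPr.
rewrite winvE -scalerAr mulrA letter_pol -mulrA letter_wj mulrA -polM winvE.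
by rewrite wweight_last addrAC addrCA subrr addr0 addrC.
Qed.

Lemma winv_letterr n r c :
  winv (wweight n r) (c * letter (wfirst n r)) =
  winv (wweight n.+1 r) c * letter (wfirst n r).
Proof.
move: c; apply: gwa_lin_ext => [d u v|d u v|p j].
- by rewrite mulPl winvP.
- by rewrite winvP mulPl.
rewrite winvE -scalerAl -mulrA letterE wjM mulrA -polM winvE.
by rewrite (wweight_first n r) -addrA [wt _ + _]addrCA subrr addr0.
Qed.

Lemma cbd_wd n r c : cind abd (cten c (wd n.+1 r)) =
  cten (letter r * c) (wd n (~~ r))
  + (-1) ^+ n.+1 *: cten (c * letter (wfirst n r)) (wd n r)
  - tr (act c 1 (acorr h0 a0 n r)).
Proof.
rewrite cind_cten abd_wd actB trB /arel actD actZ !act_ten trD trZ !tr_ten.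
by rewrite ?mulr1 ?mul1r.
Qed.

Definition crelh n r c : C (agen n) :=
  match n return C (agen n) with
  | 0%N => 0
  | n'.+1 => cten (letter r * c) (wdh n' (~~ r))
     + (-1) ^+ n'.+1 *: cten (c * letter (wfirst n' r)) (wdh n' r)
  end.

Lemma cbd_wdh n r c : cind abd (cten c (wdh n r)) =
  cten (wcomm (wweight n r) c) (wd n r) - crelh n r c.
Proof.
rewrite cind_cten abd_wdh actB trB /acomm actB trB !act_act !act_gen !tr_ten.
rewrite !mul1r ?mulr1 -(linB (@ctenP _ _ _ _)); congr (_ - _).
case: n => [|n] /=; first by rewrite act0 (lin0 (@trP _ _ _)).
by rewrite /arelh actD actZ !act_ten trD trZ !tr_ten ?mulr1 ?mul1r.
Qed.

Section CoinvariantLift.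
Variables (E : choiceType) (M : lmodType k) (f : E -> A -> M).
Hypothesis fP : forall e, linear (f e).
Definition clift (z : C E) : M := mext (fun t => f t.2 (bas t.1)) z.
Lemma cliftP : linear clift. Proof. exact: mext_is_linear. Qed.
Lemma clift_cten c e : clift (cten c e) = f e c.
Proof.
move: c; apply: balg_lin_ext => [d u v|d u v|x].
- by rewrite ctenP cliftP.
- by rewrite fP.
by rewrite ctenU /clift mextU.
Qed.
End CoinvariantLift.

Definition gwt n : agen n -> int :=
  match n return agen n -> int with
  | 0%N => fun=> 0
  | n'.+1 => fun e => match e with inl r => wweight n'.+1 r
                                 | inr q => wweight n' (wlast q) end
  end.
Lemma gwt_wd n r : gwt (wd n r) = wweight n r.
Proof. by case: n. Qed.
Lemma gwt_wdh n r : gwt (wdh n r) = wweight n r.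
Proof. by case: n. Qed.

(** The homotopy that removes non-zero weights: d[uh] contains the commutator of the coefficient
    with h, placed on [u], and theta inverts it. *)
Definition theta_gen n : agen n -> A -> C (agen n.+1) :=
  match n return agen n -> A -> C (agen n.+1) with
  | 0%N => fun _ c => cten (winv 0 c) (wdh 0 true)
  | n'.+1 => fun e c => if e is inl r
                        then cten (winv (wweight n'.+1 r) c) (wdh n'.+1 r) else 0
  end.
Lemma theta_genP n e : linear (@theta_gen n e).
Proof.
move=> c u v; case: n e => [[]|n [r|q]] /=; rewrite ?winvP ?ctenP //.
by rewrite scaler0 addr0.
Qed.
Definition theta n := clift (@theta_gen n).

Lemma theta_wd n r c : theta (cten c (wd n r)) = cten (winv (wweight n r) c) (wdh n r).
Proof. by rewrite /theta clift_cten; [case: n | exact: theta_genP]. Qed.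
Lemma theta_wdh n r c : theta (cten c (wdh n r)) = 0.
Proof. by rewrite /theta clift_cten //; exact: theta_genP. Qed.
Lemma thetaP n : linear (@theta n). Proof. exact: cliftP. Qed.

Definition piw n := clift (fun (e : agen n) c => cten (wproj (gwt e) c) e).
Lemma piw_cten n c (e : agen n) : piw (cten c e) = cten (wproj (gwt e) c) e.
Proof. by apply: clift_cten => {}e d u v; rewrite wprojP ctenP. Qed.
Lemma piwP n : linear (@piw n). Proof. exact: cliftP. Qed.

Lemma theta_acorr n r c : theta (tr (act c 1 (acorr h0 a0 n r))) = 0.
Proof.
case: n => [|n] /=; first by rewrite act0 (lin0 (@trP _ _ _)) (lin0 (@thetaP _)).
rewrite /wder; move: (lprod _); apply: poly_lin_ext => [d u v|d u v|i].
- by rewrite tderP actP trP thetaP.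
- by rewrite scaler0 addr0.
rewrite tder_Xn act_sum (lin_sum (@trP _ _ _)) (lin_sum (@thetaP _)) big1 // => s _.
by rewrite act_act act_gen tr_ten theta_wdh.
Qed.

Lemma theta_crelh n r c : theta (crelh n r c) = 0.
Proof.
case: n => [|n]; first by rewrite /crelh (lin0 (@thetaP _)).
by rewrite /crelh (linD (@thetaP _)) (linZ (@thetaP _)) !theta_wdh scaler0 addr0.
Qed.

Lemma theta_htp0 (z : C (agen 0)) : cind abd (theta z) = z - piw z.
Proof.
move: z; apply: coinv_ext => [d u v|d u v|c []].
- by rewrite thetaP cindP.
- by rewrite piwP scalerBr opprD addrACA.
rewrite -/(wd 0 true) theta_wd cbd_wdh subr0 wcomm_winv piw_cten.
by rewrite (linB (@ctenP _ _ _ _)).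
Qed.

Lemma theta_htpS n (z : C (agen n.+1)) :
  cind abd (theta z) + theta (cind abd z) = z - piw z.
Proof.
move: z; apply: coinv_ext => [d u v|d u v|c].
- by rewrite thetaP !cindP thetaP scalerDr addrACA.
- by rewrite piwP scalerBr opprD addrACA.
apply: agenP => r; rewrite piw_cten ?gwt_wd ?gwt_wdh.
  rewrite theta_wd cbd_wdh cbd_wd wcomm_winv (linB (@ctenP _ _ _ _)).
  rewrite (linB (@thetaP _)) theta_acorr subr0 (linD (@thetaP _)) (linZ (@thetaP _)).
  by rewrite !theta_wd winv_letterl winv_letterr subrK.
rewrite theta_wdh (lin0 (@cindP _ _ _ _ _)) add0r cbd_wdh (linB (@thetaP _)).
by rewrite theta_crelh subr0 theta_wd winv_wcomm (linB (@ctenP _ _ _ _)).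
Qed.

Lemma cbd_cbd n (z : C (agen n.+2)) : cind abd (cind abd z) = 0.
Proof.
rewrite cind_comp (eq_cind (@rbd_rbd _ _ (gwa_resolution h0 a0) n)).
move: z; apply: coinv_ext => [d u v|d u v|c e].
- by rewrite cindP.
- by rewrite scaler0 addr0.
by rewrite cind_cten act0 (lin0 (@trP _ _ _)).
Qed.

(** [piw] equals 1 - (d theta + theta d), hence commutes with d. *)
Lemma cbd_piw n (z : C (agen n.+1)) : cind abd (piw z) = piw (cind abd z).
Proof.
have piE : piw z = z - (cind abd (theta z) + theta (cind abd z)).
  by rewrite theta_htpS opprB addrCA subrr addr0.
rewrite piE (linB (@cindP _ _ _ _ _)) (linD (@cindP _ _ _ _ _)) cbd_cbd add0r.
case: n z piE => [|n] z piE; first by rewrite theta_htp0 opprB addrCA subrr addr0.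
have := theta_htpS (cind abd z).
rewrite cbd_cbd (lin0 (@thetaP _)) addr0 => ->.
by rewrite opprB addrCA subrr addr0.
Qed.

End Weights.

(* [wZ n r p] and [wH n r p] are the elements of total weight 0 with coefficient p
   on the generators [u] and [uh], u being the word of length n ending in r. *)
HB.lock Definition wZ (k : fieldType) (a : {poly k}) (h0 : k) (a0 : a != 0) (n : nat) (r : bool)
    (p : {poly k}) : {malg k[(bkey (gwa_basis h0 a0) * agen n)%type]} :=
  cten (pol h0 a0 p * wj h0 a0 (- wweight n r)) (wd n r).

HB.lock Definition wH (k : fieldType) (a : {poly k}) (h0 : k) (a0 : a != 0) (n : nat) (r : bool)
    (p : {poly k}) : {malg k[(bkey (gwa_basis h0 a0) * agen n.+1)%type]} :=
  cten (pol h0 a0 p * wj h0 a0 (- wweight n r)) (wdh n r).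

Section WeightZero.
Variables (k : fieldType) (a : {poly k}) (h0 : k) (a0 : a != 0).
Local Notation sg := (sigmaz h0).
Local Notation B := (gwa_basis h0 a0).
Local Notation pol := (pol h0 a0).
Local Notation wj := (wj h0 a0).
Local Notation letter := (letter h0 a0).
Local Notation lprod := (lprod a h0).
Local Notation abd := (@abd k a h0 a0 _).
Local Notation wcoord := (@wcoord k a h0 a0).
Local Notation wZ := (@wZ k a h0 a0).
Local Notation wH := (@wH k a h0 a0).
Local Notation piw := (@piw k a h0 a0 _).
Local Notation "'C' E" := {malg k[(bkey B * E)%type]} (at level 10, E at level 9).

Lemma wZP n r : linear (wZ n r).
Proof. by move=> c u v; rewrite wZ.unlock polP mulPl ctenP. Qed.
Lemma wHP n r : linear (wH n r).
Proof. by move=> c u v; rewrite wH.unlock polP mulPl ctenP. Qed.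

Section CoordLift.
Variables (n : nat) (M : lmodType k) (f : agen n -> {poly k} -> M).
Hypothesis fP : forall e, linear (f e).
(** Such a map sees only weight-zero coordinates and therefore factors through [piw]. *)
Definition wlift : C (agen n) -> M := clift (fun e c => f e (wcoord (gwt e) c)).
Lemma wliftP : linear wlift. Proof. exact: cliftP. Qed.
Lemma wlift_cten c e : wlift (cten c e) = f e (wcoord (gwt e) c).
Proof. by rewrite /wlift clift_cten // => {}e d u v; rewrite wcoordP fP. Qed.
Lemma wlift_piw z : wlift (piw z) = wlift z.
Proof.
move: z; apply: coinv_ext => [d u v|d u v|c e].
- by rewrite piwP wliftP.
- by rewrite wliftP.
by rewrite piw_cten !wlift_cten wcoord_wproj.
Qed.
Lemma wlift_wZ r p : wlift (wZ n r p) = f (wd n r) p.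
Proof. by rewrite wZ.unlock wlift_cten gwt_wd wcoordE addNr eqxx. Qed.
End CoordLift.

Lemma wlift_wH n (M : lmodType k) (f : agen n.+1 -> {poly k} -> M) r p :
  (forall e, linear (f e)) -> wlift f (wH n r p) = f (wdh n r) p.
Proof. by move=> fP; rewrite wH.unlock wlift_cten // gwt_wdh wcoordE addNr eqxx. Qed.

Lemma piw_ext0 (M : lmodType k) (F G : C (agen 0) -> M) : linear F -> linear G ->
  (forall p, F (wZ 0 true p) = G (wZ 0 true p)) -> forall z, F (piw z) = G (piw z).
Proof.
move=> lF lG FG; apply: coinv_ext => [d u v|d u v|c []].
- by rewrite piwP lF.
- by rewrite piwP lG.
by rewrite piw_cten wprojEcoord; have := FG (wcoord 0 c); rewrite wZ.unlock.
Qed.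

Lemma piw_extS n (M : lmodType k) (F G : C (agen n.+1) -> M) : linear F -> linear G ->
  (forall r p, F (wZ n.+1 r p) = G (wZ n.+1 r p)) ->
  (forall r p, F (wH n r p) = G (wH n r p)) ->
  forall z, F (piw z) = G (piw z).
Proof.
move=> lF lG FGZ FGH; apply: coinv_ext => [d u v|d u v|c].
- by rewrite piwP lF.
- by rewrite piwP lG.
apply: agenP => r; rewrite piw_cten wprojEcoord.
  by have := FGZ r (wcoord (wweight n.+1 r) c); rewrite wZ.unlock -gwt_wd.
by have := FGH r (wcoord (wweight n r) c); rewrite wH.unlock -gwt_wdh.
Qed.

(** The terms [u'']r + (-1)^m l[u'] of the differential in weight 0, for m = n+1. For odd m the
    coefficient contains a letter of opposite weight, which multiplies with r or l to an [lprod];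
    for even m no such product arises. *)
Definition wrel (M : lmodType k) (X : bool -> {poly k} -> M) (n : nat) r p : M :=
  if odd n then X (~~ r) (sg (wt r) p) + X r p
  else X (~~ r) (sg (wt r) p * lprod r) - X r (p * lprod (~~ r)).

Lemma wweightS n r : wweight n.+1 r = if odd n then 0 else wt r.
Proof. by rewrite /wweight /=; case: (odd n). Qed.

Lemma letter_weight n r p :
  letter r * (pol p * wj (- wweight n.+1 r)) =
  pol (sg (wt r) p * (if odd n then 1 else lprod r)) * wj (- wweight n (~~ r)).
Proof.
rewrite mulrA letter_pol -mulrA letter_wj mulrA -polM; congr (pol (_ * _) * wj _).
  rewrite wweightS; case: (odd n); first by rewrite oppr0 wcoef0r.
  by rewrite -wtN.
by rewrite wweight_last opprB.
Qed.

Lemma weight_letter n r p :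
  pol p * wj (- wweight n.+1 r) * letter (wfirst n r) =
  pol (p * (if odd n then 1 else lprod (~~ r))) * wj (- wweight n r).
Proof.
rewrite -mulrA letterE wjM mulrA -polM; congr (pol (_ * _) * wj _).
  rewrite wweightS /wfirst; case: (odd n); first by rewrite oppr0 wcoef0l.
  by rewrite -wtN addbF lprodN.
by rewrite (wweight_first n r) opprB addrC.
Qed.

Definition wcorr n r (p : {poly k}) : C (agen n) :=
  match n return C (agen n) with
  | 0%N => 0 | n'.+1 => wH n' r ((lprod (~~ r))^`() * p) end.

Definition wrelH n r (p : {poly k}) : C (agen n) :=
  match n return C (agen n) with
  | 0%N => 0 | n'.+1 => wrel (wH n') n' r p end.

(** In weight 0 the coefficient w_(-w) undoes the twist sigma^w, so each of the i summands of D(h^i)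
    gives h^(i-1) and D(p) becomes p'. *)
Lemma tr_acorr n r p :
  tr (act (pol p * wj (- wweight n.+1 r)) 1 (acorr h0 a0 n r)) = wcorr n r p.
Proof.
case: n => [|n] /=; first by rewrite act0 (lin0 (@trP _ _ _)).
have -> : wweight n.+2 r = wweight n r by rewrite /wweight /= negbK.
rewrite /wder; move: (lprod _); apply: poly_lin_ext => [d u v|d u v|i].
- by rewrite tderP actP trP.
- by rewrite linearP /= mulrDl -scalerAl wHP.
rewrite tder_Xn act_sum (lin_sum (@trP _ _ _)).
rewrite (eq_bigr (fun=> wH n r ('X^(i.-1) * p))) => [|s _]; last first.
  rewrite act_act act_gen tr_ten mulr1 -[pol p * _ * _]mulrA wj_pol -sigmazD addNr sigmaz0.
  rewrite !mulrA -!polM wH.unlock mulrAC -exprD subnK //.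
  by have := ltn_ord s; lia.
rewrite sumr_const card_ord derivXn -[X in _ = wH n r (X * _)]scaler_nat -scalerAl.
by rewrite (linZ (wHP _ _)) scaler_nat.
Qed.

Lemma cbd_wZ n r p : cind abd (wZ n.+1 r p) = wrel (wZ n) n r p - wcorr n r p.
Proof.
rewrite {1}wZ.unlock cbd_wd tr_acorr letter_weight weight_letter; congr (_ - _).
rewrite /wrel wZ.unlock -signr_odd oddS; case: (odd n).
  by rewrite !mulr1 expr0 scale1r.
by rewrite expr1 scaleN1r.
Qed.

Lemma cbd_wH n r p : cind abd (wH n r p) = - wrelH n r p.
Proof.
rewrite {1}wH.unlock cbd_wdh wcommE addNr mul0r scale0r (lin0 (@ctenP _ _ _ _)) sub0r.
congr (- _); case: n => [|n] //=.
rewrite letter_weight weight_letter /wrel wH.unlock -[X in X *: _]signr_odd oddS.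
case: (odd n).
  by rewrite !mulr1 expr0 scale1r.
by rewrite expr1 scaleN1r.
Qed.

End WeightZero.

(** * The complex of polynomials *)

(** From even to odd length, the letter-dropping part [wrel] is (p, q) -> (p + sigma^-1 q, sigma p +
    q) on the components ending in x and y. For even m > 0 the formula parametrises its kernel, for
    odd m a complement of its image; the empty word has a single component. *)
HB.lock Definition iota_word (k : fieldType) (h0 : k) (M : lmodType k)
    (X : bool -> {poly k} -> M) (m : nat) (q : {poly k}) : M :=
  X true q - (if (0 < m)%N && ~~ odd m then X false (sigmaz h0 1 q) else 0).

Section SmallComplex.
Variables (k : fieldType) (a : {poly k}) (h0 : k) (a0 : a != 0).
Hypothesis chark : [pchar k] =i pred0.
Hypothesis h00 : h0 != 0.
Local Notation sg := (sigmaz h0).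
Local Notation B := (gwa_basis h0 a0).
Local Notation lprod := (lprod a h0).
Local Notation abd := (@abd k a h0 a0 _).
Local Notation wZ := (@wZ k a h0 a0).
Local Notation wH := (@wH k a h0 a0).
Local Notation piw := (@piw k a h0 a0 _).
Local Notation wlift := (@wlift k a h0 a0 _ _).
Local Notation "'C' E" := {malg k[(bkey B * E)%type]} (at level 10, E at level 9).

Definition sdelta (p : {poly k}) : {poly k} := sg 1 p - p.
Lemma sdeltaP : linear sdelta.
Proof. by move=> c u v; rewrite /sdelta sigmazP scalerBr opprD addrACA. Qed.

Definition small (n : nat) : lmodType k :=
  if n is _.+1 then (({poly k} * {poly k})%type : lmodType k) else ({poly k} : lmodType k).

Arguments small : simpl never.

(** In degree n > 0 the first coordinate belongs to [u] with u of length n, the second to [uh] with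
    u of length n-1. *)
Definition small_bd (n : nat) : small n.+1 -> small n :=
  match n return small n.+1 -> small n with
  | 0%N => fun u => sdelta (a * u.1)
  | 1%N => fun u => (0, sdelta (a^`() * u.1 - a * u.2))
  | n'.+2 => fun u => if odd n' then (0, a * u.2 - a^`() * u.1)
                      else (- (a * u.1), - (a^`() * u.1))
  end.

Lemma pairP (U V : lmodType k) (u v : U * V) : u.1 = v.1 -> u.2 = v.2 -> u = v.
Proof. by case: u v => [? ?] [? ?] /= -> ->. Qed.

Lemma small_bdP n : linear (@small_bd n).
Proof.
case: n => [|[|n]] c u v /=.
- by rewrite mulrDr -scalerAr sdeltaP.
- apply: pairP => /=; rewrite ?scaler0 ?addr0 // -sdeltaP; congr sdelta.
  by rewrite !mulrDr -!scalerAr scalerBr opprD addrACA.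
- by case: (odd n); apply: pairP => /=; rewrite ?scaler0 ?addr0 // !mulrDr -!scalerAr
    ?scalerBr ?scalerN opprD // addrACA.
Qed.

Definition small_inj n : small n -> C (agen n) :=
  match n return small n -> C (agen n) with
  | 0%N => fun q => wZ 0 true q
  | n'.+1 => fun u => iota_word h0 (wZ n'.+1) n'.+1 u.1 + iota_word h0 (wH n') n' u.2
  end.

Lemma iota_wordP (M : lmodType k) (X : bool -> {poly k} -> M) m :
  (forall r, linear (X r)) -> linear (iota_word h0 X m).
Proof.
move=> lX c u v; rewrite iota_word.unlock sigmazP !lX scalerBr.
by case: ifP => _; rewrite ?scaler0 ?oppr0 ?addr0 // opprD addrACA.
Qed.

Lemma small_injP n : linear (@small_inj n).
Proof.
case: n => [|n] c u v /=; first by rewrite wZP.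
rewrite (iota_wordP _ (@wZP _ _ h0 a0 n.+1)) (iota_wordP _ (@wHP _ _ h0 a0 n)).
by rewrite scalerDr addrACA.
Qed.

(** A left inverse of [iota_word]; in odd length it kills the image of [wrel], which consists of the
    pairs (p, sigma p). *)
Definition small_coord (m : nat) (r : bool) (p : {poly k}) : {poly k} :=
  if m == 0%N then p
  else if r then p else if odd m then - sg (- 1) p else 0.

Lemma small_coordP m r : linear (small_coord m r).
Proof.
move=> c u v; rewrite /small_coord sigmazP.
by case: (m == _); case: r => //; case: (odd m); rewrite ?scaler0 ?addr0 // scalerN opprD.
Qed.

(** The extra entry in degree 1: [y] with coefficient p is rewritten modulo the boundary of
    [wZ 2 false p], whose derivation term puts sigma(a') p on [h]. In higher odd degrees that term
    lands on a component killed by [small_coord]. *)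
Definition small_proj_gen n : agen n -> {poly k} -> small n :=
  match n return agen n -> {poly k} -> small n with
  | 0%N => fun _ p => p
  | n'.+1 => fun e p => match e with
     | inl r => (small_coord n'.+1 r p,
                 if (n' == 0%N) && ~~ r then sg 1 a^`() * p else 0)
     | inr q => (0, small_coord n' (wlast q) p) end
  end.

Lemma small_proj_genP n e : linear (@small_proj_gen n e).
Proof.
move=> c u v; case: n e => [|n] // [r|q] /=; apply: pairP => /=;
  rewrite ?scaler0 ?addr0 ?small_coordP //.
case: ifP => _; rewrite ?scaler0 ?addr0 //.
by rewrite mulrDr -scalerAr.
Qed.

Definition small_proj n : C (agen n) -> small n := wlift (@small_proj_gen n).
Lemma small_projP n : linear (@small_proj n). Proof. exact: wliftP. Qed.
Lemma small_proj_piw n z : @small_proj n (piw z) = small_proj z.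
Proof. exact/wlift_piw/small_proj_genP. Qed.
Lemma small_proj_wZ0 r p : small_proj (wZ 0 r p) = p.
Proof. by rewrite /small_proj wlift_wZ //; exact: small_proj_genP. Qed.
Lemma small_proj_wZ n r p : small_proj (wZ n.+1 r p) =
  (small_coord n.+1 r p, if (n == 0%N) && ~~ r then sg 1 a^`() * p else 0).
Proof. by rewrite /small_proj wlift_wZ //; exact: small_proj_genP. Qed.
Lemma small_proj_wH n r p : small_proj (wH n r p) = (0, small_coord n r p).
Proof.
rewrite /small_proj wlift_wH; last exact: small_proj_genP.
by case: n => [|n].
Qed.

(* The contraction of the acyclic pairs that [small_proj] discards. *)
Definition kappa_gen n : agen n -> {poly k} -> C (agen n.+1) :=
  match n return agen n -> {poly k} -> C (agen n.+1) with
  | 0%N => fun _ _ => 0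
  | n'.+1 => fun e p => match e with
     | inl r => if odd n'.+1 && ~~ r then wZ n'.+2 false p else 0
     | inr q => if odd n' && ~~ wlast q then - wH n'.+1 false p else 0 end
  end.
Lemma kappa_genP n e : linear (@kappa_gen n e).
Proof.
move=> c u v; case: n e => [|n] => [_|[r|q]] /=; rewrite ?scaler0 ?addr0 //;
  case: ifP => _; rewrite ?scaler0 ?addr0 // ?wZP // wHP opprD scalerN //.
Qed.
Definition kappa n : C (agen n) -> C (agen n.+1) := wlift (@kappa_gen n).
Lemma kappaP n : linear (@kappa n). Proof. exact: wliftP. Qed.
Lemma kappa_wZ n r p : kappa (wZ n r p) = if odd n && ~~ r then wZ n.+1 false p else 0.
Proof. by rewrite /kappa wlift_wZ; [case: n | exact: kappa_genP]. Qed.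
Lemma kappa_wH n r p : kappa (wH n r p) = if odd n && ~~ r then - wH n.+1 false p else 0.
Proof. by rewrite /kappa wlift_wH; [case: n | exact: kappa_genP]. Qed.

Lemma deriv_sigmaz l p : (sg l p)^`() = sg l p^`().
Proof. by rewrite /sigmaz deriv_comp derivB derivX derivC subr0 mulr1. Qed.

Lemma sg1K p : sg (- 1) (sg 1 p) = p. Proof. exact: sigmazK. Qed.
Lemma sgN1K p : sg 1 (sg (- 1) p) = p.
Proof. by rewrite -sigmazD addrN sigmaz0. Qed.

Lemma wZ0 r p : wZ 0 r p = wZ 0 true p.
Proof. by rewrite wZ.unlock. Qed.
Lemma wH0 r p : wH 0 r p = wH 0 true p.
Proof. by rewrite wH.unlock. Qed.

Section WrelIota.
Variables (M : lmodType k) (X : bool -> {poly k} -> M).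
Hypothesis XP : forall r, linear (X r).

Lemma wrel_true n p : wrel a h0 X n true p =
  if odd n then X false (sg 1 p) + X true p else X false (sg 1 (p * a)) - X true (p * a).
Proof. by rewrite /wrel lprod_true lprod_false sigmazM. Qed.
Lemma wrel_false n p : wrel a h0 X n false p =
  if odd n then X true (sg (- 1) p) + X false p
  else X true (sg (- 1) p * a) - X false (p * sg 1 a).
Proof. by rewrite /wrel lprod_true lprod_false. Qed.

Lemma wrel_iota_odd n q : odd n ->
  wrel a h0 X n true q - wrel a h0 X n false (sg 1 q) = 0.
Proof.
by move=> on; rewrite wrel_true wrel_false on sg1K addrC [X true q + _]addrC addNr.
Qed.

Lemma wrel_iota_even n q : (0 < n)%N -> ~~ odd n ->
  wrel a h0 X n true q = iota_word h0 X n (- (a * q)).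
Proof.
move=> n0 on; rewrite wrel_true (negbTE on) iota_word.unlock n0 on /=.
rewrite (linN (@sigmazP _ _ _)) !(linN (XP _)) opprK addrC.
by rewrite mulrC.
Qed.
End WrelIota.

Lemma wrel_iota0 q :
  wrel a h0 (wZ 0) 0 true q = wZ 0 true (sdelta (a * q)).
Proof. by rewrite wrel_true /= (wZ0 false) /sdelta (linB (@wZP _ _ _ _ _ _)) mulrC. Qed.
Lemma wrel_iotaH0 q : wrel a h0 (wH 0) 0 true q = wH 0 true (sdelta (a * q)).
Proof. by rewrite wrel_true /= (wH0 false) /sdelta (linB (@wHP _ _ _ _ _ _)) mulrC. Qed.

Lemma wcorr_true n p : wcorr h0 a0 n.+1 true p = wH n true (a^`() * p).
Proof. by rewrite /wcorr lprod_false. Qed.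
Lemma wcorr_false n p : wcorr h0 a0 n.+1 false p = wH n false (sg 1 a^`() * p).
Proof. by rewrite /wcorr lprod_true deriv_sigmaz. Qed.

Lemma cbd_iota_wZ1 q : cind abd (iota_word h0 (wZ 1) 1 q) = wZ 0 true (sdelta (a * q)).
Proof. by rewrite iota_word.unlock subr0 cbd_wZ subr0 wrel_iota0. Qed.

Lemma cbd_iota_wZ n q : cind abd (iota_word h0 (wZ n.+2) n.+2 q) =
  if odd n then iota_word h0 (wZ n.+1) n.+1 (- (a * q)) + iota_word h0 (wH n) n (- (a^`() * q))
  else if n == 0%N then wH n true (sdelta (a^`() * q)) else iota_word h0 (wH n) n (- (a^`() * q)).
Proof.
rewrite {1}iota_word.unlock /= negbK; case on: (odd n) => /=.
  rewrite subr0 cbd_wZ wcorr_true wrel_iota_even //=; last first.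
  - by rewrite on.
  - exact: wZP.
  by rewrite [in X in _ = _ + X]iota_word.unlock on andbF subr0 (linN (@wHP _ _ _ _ _ _)).
rewrite (linB (@cindP _ _ _ _ _)) !cbd_wZ wcorr_true wcorr_false.
rewrite opprB [X in _ + X]addrC addrACA wrel_iota_odd ?add0r //=; last by rewrite on.
case: eqP => [n0|/eqP n0].
  subst n; rewrite (wH0 false) -sigmazM /sdelta (linB (@wHP _ _ _ _ _ _)) addrC.
  by [].
rewrite iota_word.unlock lt0n n0 on /= (linN (@sigmazP _ _ _)) !(linN (@wHP _ _ _ _ _ _)).
by rewrite opprK sigmazM.
Qed.

Lemma cbd_iota_wH0 q : cind abd (iota_word h0 (wH 0) 0 q) = 0.
Proof. by rewrite iota_word.unlock subr0 cbd_wH oppr0. Qed.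

Lemma cbd_iota_wH n q : cind abd (iota_word h0 (wH n.+1) n.+1 q) =
  if odd n then 0
  else if n == 0%N then wH n true (- sdelta (a * q)) else iota_word h0 (wH n) n (a * q).
Proof.
rewrite {1}iota_word.unlock /=; case on: (odd n) => /=.
  rewrite (linB (@cindP _ _ _ _ _)) !cbd_wH opprK addrC -[LHS]opprB /=.
  by rewrite wrel_iota_odd // oppr0.
rewrite subr0 cbd_wH /=; case: eqP => [n0|/eqP n0].
  by subst n; rewrite wrel_iotaH0 (linN (@wHP _ _ _ _ _ _)).
rewrite wrel_iota_even ?on ?lt0n //; last exact: wHP.
by rewrite (linN (@iota_wordP _ _ _ (@wHP _ _ _ _ _))) opprK.
Qed.

Lemma iota_word0 (M : lmodType k) (X : bool -> {poly k} -> M) q : iota_word h0 X 0 q = X true q.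
Proof. by rewrite iota_word.unlock subr0. Qed.

Lemma small_inj_bd n (u : small n.+1) : cind abd (small_inj u) = small_inj (small_bd u).
Proof.
case: n u => [|[|n]] u; rewrite [small_inj u]/= (linD (@cindP _ _ _ _ _)).
- by rewrite cbd_iota_wZ1 cbd_iota_wH0 addr0.
- rewrite cbd_iota_wZ cbd_iota_wH /= iota_word0 (lin0 (iota_wordP _ (@wZP _ _ h0 a0 1))).
  by rewrite add0r -(linD (@wHP _ _ _ _ _ _)) -(linB sdeltaP).
rewrite cbd_iota_wZ cbd_iota_wH [small_bd u]/= [odd n.+1]/=.
case on: (odd n) => /=; last by rewrite addr0.
rewrite (lin0 (iota_wordP _ (@wZP _ _ h0 a0 n.+2))) add0r.
by rewrite -(linD (iota_wordP _ (@wHP _ _ h0 a0 n.+1))) addrC.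
Qed.

Lemma small_coord_true n p : small_coord n true p = p.
Proof. by rewrite /small_coord; case: ifP. Qed.
Lemma small_coord_false n p : small_coord n.+1 false p = if odd n then 0 else - sg (- 1) p.
Proof. by rewrite /small_coord /=; case: (odd n). Qed.
Lemma small_coord0 r p : small_coord 0 r p = p. Proof. by []. Qed.

Lemma small_proj_bd n (z : C (agen n.+1)) :
  small_proj (cind abd z) = small_bd (small_proj z).
Proof.
(* Both sides factor through [piw], so weight-zero elements suffice. *)
rewrite -small_proj_piw -cbd_piw // -[in RHS]small_proj_piw.
move: z; apply: (piw_extS (F := fun y => small_proj (cind abd y))
  (G := fun y => small_bd (small_proj y))) => [d u v|d u v|r p|r p].
- by rewrite cindP small_projP.
- by rewrite small_projP small_bdP.
- rewrite cbd_wZ (linB (@small_projP _)).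
  case: n => [|[|n]].
  + rewrite (lin0 (@small_projP _)) subr0 small_proj_wZ /=.
    case: r; rewrite ?wrel_true ?wrel_false /= (linB (@small_projP _)) !small_proj_wZ0.
      by rewrite small_coord_true /sdelta mulrC.
    by rewrite small_coord_false /= /sdelta mulrN (linN (@sigmazP _ _ _)) sigmazM sgN1K; ring.
  + rewrite small_proj_wZ; case: r; rewrite ?wrel_true ?wrel_false /=;
      rewrite ?lprod_false ?lprod_true (linD (@small_projP _)) !small_proj_wZ small_proj_wH;
      rewrite ?small_coord_true !small_coord_false /=; apply: pairP => /=.
    * by rewrite sg1K; ring.
    * by rewrite /sdelta mulr0 subr0 sigmazM; ring.
    * by ring.
    * rewrite small_coord0 !mulr0 subrr (lin0 sdeltaP) deriv_sigmaz.
      by ring.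
  + rewrite small_proj_wZ; case: r; rewrite ?wrel_true ?wrel_false /= negbK;
      rewrite ?lprod_false ?lprod_true ?deriv_sigmaz; case on: (odd n) => /=;
      rewrite ?(linB (@small_projP _)) ?(linD (@small_projP _)) !small_proj_wZ small_proj_wH;
      rewrite ?small_coord_true !small_coord_false /= on /=; apply: pairP => /=;
      rewrite ?sigmazM ?sg1K; try ring.
- rewrite cbd_wH (linN (@small_projP _)) small_proj_wH.
  case: n => [|[|n]].
  + by rewrite (lin0 (@small_projP _)) /= mulr0 (lin0 sdeltaP) oppr0.
  + rewrite /wrelH /small_bd /=; case: r; rewrite ?wrel_true ?wrel_false /=;
    rewrite (linB (@small_projP _)) !small_proj_wH !small_coord0 /sdelta;
    rewrite ?small_coord_true ?small_coord_false /=; apply: pairP => /=; try ring.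
    by rewrite !mulrN !mulr0 !sub0r !opprK !sigmazM sgN1K; ring.
  + rewrite /wrelH /small_bd /=; case: r; rewrite ?wrel_true ?wrel_false /=;
    case on: (odd n) => /=;
    rewrite ?(linB (@small_projP _)) ?(linD (@small_projP _)) !small_proj_wH;
    rewrite ?small_coord_true ?small_coord_false /= on /=; apply: pairP => /=;
    rewrite ?sigmazM ?sg1K; try ring.
Qed.

Lemma small_injK n : cancel (@small_inj n) (@small_proj n).
Proof.
have iotaE (m : nat) (q : {poly k}) :
    small_coord m true q - (if (0 < m)%N && ~~ odd m then small_coord m false (sg 1 q) else 0) = q.
  rewrite small_coord_true; case: m => [|m]; first by rewrite subr0.
  by rewrite small_coord_false /= negbK; case: (odd m); rewrite subr0.
case: n => [|n] u; first exact: small_proj_wZ0.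
rewrite /small_inj (linD (@small_projP _)) !iota_word.unlock.
have ifE b (x : C (agen n.+1)) :
    small_proj (if b then x else 0) = if b then small_proj x else 0.
  by case: b => //; rewrite (lin0 (@small_projP _)).
rewrite !(linB (@small_projP _)) !ifE !small_proj_wZ !small_proj_wH.
have := iotaE n.+1 u.1; have := iotaE n u.2; rewrite !small_coord_true; clear ifE.
case: n u => [|n] u /=.
  by move=> _ _; apply: pairP; rewrite /= ?subr0 ?addr0 ?add0r.
by rewrite negbK; case: (odd n) => /= e2 e1; apply: pairP;
  rewrite /= ?(subr0, addr0, add0r, subrr).
Qed.

Lemma kappa_htp0 (z : C (agen 0)) : piw z = small_inj (small_proj (piw z)).
Proof.
move: z; apply: (piw_ext0 (F := id) (G := fun z => small_inj (small_proj z))) => //.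
- by move=> c u v; rewrite small_projP small_injP.
- by move=> p; rewrite small_proj_wZ0.
Qed.

Lemma kappa_wrel_even n (X : bool -> {poly k} -> C (agen n)) m r p : ~~ odd m ->
  (forall r q, kappa (X r q) = 0) -> kappa (wrel a h0 X m r p) = 0.
Proof.
move=> om X0; rewrite /wrel (negbTE om) (linB (@kappaP _)) !X0.
exact: subrr.
Qed.

Lemma kappa_htpS n (z : C (agen n.+1)) :
  cind abd (kappa (piw z)) + kappa (cind abd (piw z)) =
  piw z - small_inj (small_proj (piw z)).
Proof.
move: z; apply: (piw_extS (F := fun y => cind abd (kappa y) + kappa (cind abd y))
  (G := fun y => y - small_inj (small_proj y))) => [d u v|d u v|r p|r p].
- by rewrite kappaP !cindP kappaP scalerDr addrACA.
- by rewrite small_projP small_injP scalerBr opprD addrACA.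
- rewrite small_proj_wZ kappa_wZ cbd_wZ (linB (@kappaP _)) /small_inj.
  case: n => [|n].
    rewrite kappa_wrel_even // => [|? ?]; last by rewrite kappa_wZ.
    rewrite (lin0 (@kappaP _)) subr0 addr0 iota_word0 iota_word.unlock subr0 /=; case: r => /=.
      rewrite (lin0 (@cindP _ _ _ _ _)) (lin0 (@wHP _ _ _ _ _ _)) addr0 small_coord_true.
      by rewrite subrr.
    rewrite cbd_wZ wcorr_false wrel_false /= (wH0 false) small_coord_false /=.
    by rewrite (linN (@wZP _ _ _ _ _ _)) opprD opprK addrA [X in X - _]addrC.
  rewrite [fst _]/= [snd _]/=.
  rewrite (lin0 (iota_wordP _ (@wHP _ _ h0 a0 n.+1))) addr0 [wcorr _ _ _ _ _]/= kappa_wH.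
  rewrite [odd n.+2]/= negbK; case on: (odd n).
    rewrite kappa_wrel_even /= ?on // => [|? ?]; last by rewrite kappa_wZ /= on.
    rewrite iota_word.unlock /= negbK on subr0; case: r => /=.
      rewrite small_coord_true (lin0 (@cindP _ _ _ _ _)) subr0 addr0 subrr.
      by [].
    rewrite cbd_wZ wcorr_false wrel_false /= on /= small_coord_false /= on /=.
    rewrite lprod_true deriv_sigmaz (linN (@wZP _ _ _ _ _ _)) !opprK add0r subrK.
    by rewrite addrC.
  rewrite (lin0 (@cindP _ _ _ _ _)) subr0 add0r iota_word.unlock /= negbK on /=.
  case: r; rewrite ?wrel_true ?wrel_false /= on (linD (@kappaP _)) !kappa_wZ /= on /=.
    by rewrite small_coord_true addr0 opprB addrCA subrr addr0.
  rewrite small_coord_false /= on /= add0r (lin0 (@sigmazP _ _ _)).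
  by rewrite !(lin0 (@wZP _ _ _ _ _ _)) !subr0.
- rewrite small_proj_wH kappa_wH cbd_wH (linN (@kappaP _)) /small_inj.
  rewrite [fst _]/= [snd _]/= (lin0 (iota_wordP _ (@wZP _ _ h0 a0 n.+1))) add0r.
  case: n => [|n].
    rewrite (lin0 (@kappaP _)) oppr0 addr0 (lin0 (@cindP _ _ _ _ _)) iota_word0.
    by rewrite small_coord0 wH0 subrr.
  rewrite [odd n.+1]/= [wrelH _ _ _ _ _]/=; case on: (odd n).
    rewrite (lin0 (@cindP _ _ _ _ _)) add0r iota_word.unlock /= on /=.
    case: r; rewrite ?wrel_true ?wrel_false on (linD (@kappaP _)) !kappa_wH on /=.
      by rewrite small_coord_true addr0 opprK opprB addrCA subrr addr0.
    rewrite small_coord_false on add0r opprK (lin0 (@sigmazP _ _ _)).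
    by rewrite !(lin0 (@wHP _ _ _ _ _ _)) !subr0.
  rewrite kappa_wrel_even ?on // => [|? ?]; last by rewrite kappa_wH on.
  rewrite subr0 iota_word.unlock /= on subr0; case: r => /=.
    by rewrite small_coord_true (lin0 (@cindP _ _ _ _ _)) subrr.
  rewrite (linN (@cindP _ _ _ _ _)) cbd_wH opprK small_coord_false on /= wrel_false /= on /=.
  by rewrite (linN (@wHP _ _ _ _ _ _)) opprK addrC.
Qed.

(** The two homotopies add up: for a cycle z, [theta z], plus [kappa (piw z)] in positive degree,
    bounds the difference of z and its image under projection and injection. *)
Lemma hdim_small n r : hdim (@small_bd) n r ->
  @hdim k (fun n => C (agen n)) (fun n (z : C (agen n.+1)) => cind abd z) n r.
Proof.
apply: (hdim_equiv (f := @small_inj) (g := @small_proj)).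
- exact: small_bdP.
- by move=> m; apply: cindP.
- exact: small_injP.
- by move=> m; apply: wliftP.
- exact: small_inj_bd.
- by move=> m z; rewrite small_proj_bd.
- move=> m z _; exists 0; rewrite (lin0 (@small_bdP _)).
  by rewrite small_injK subrr.
- move=> [|m] z zC.
    exists (theta (a := a) (h0 := h0) (a0 := a0) z); rewrite theta_htp0 //; congr (_ - _).
    by rewrite kappa_htp0 small_proj_piw.
  exists (theta (a := a) (h0 := h0) (a0 := a0) z + kappa (piw z)).
  have := theta_htpS chark h00 z; have := kappa_htpS z.
  rewrite cbd_piw // zC (lin0 (@piwP _ _ _ _ _)) (lin0 (@kappaP _)) (lin0 (@thetaP _ _ _ _ _)).
  rewrite !addr0 (linD (@cindP _ _ _ _ _)) => -> ->.
  by rewrite small_proj_piw addrA subrK.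
Qed.

End SmallComplex.

(** * Homology of the complex of polynomials *)

Section SmallHomology.
Variables (k : fieldType) (a : {poly k}) (h0 : k) (a0 : a != 0).
Hypothesis chark : [pchar k] =i pred0.
Hypothesis h00 : h0 != 0.
Local Notation sg := (sigmaz h0).
Local Notation sdelta := (sdelta h0).

(** * The operator sigma - 1 on k[h], and bases of quotients *)

Lemma sdeltaC c : sdelta c%:P = 0.
Proof. by rewrite /sdelta sigmazC subrr. Qed.

Lemma size_sdelta_Xn m :
  (size (sdelta 'X^(m.+1) + (m.+1%:R * h0) *: 'X^m)%R <= m)%N.
Proof.
have XE : sg 1 'X = 'X - h0%:P by rewrite sigmazX mul1r.
rewrite /sdelta; elim: m => [|m IHm].
  by rewrite !expr1 XE mul1r expr0 alg_polyC addrAC addrNK subrr size_poly0.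
pose E : {poly k} := sg 1 'X^(m.+1) - 'X^(m.+1) + (m.+1%:R * h0) *: 'X^m.
(* Multiplying the remainder for h^(m+1) by h - h0 gives the one for h^(m+2), up to a multiple of
   h^m. *)
have -> : sg 1 'X^(m.+2) - 'X^(m.+2) + (m.+2%:R * h0) *: 'X^(m.+1) =
    ('X - h0%:P) * E + (m.+1%:R * h0 ^+ 2) *: 'X^m.
  rewrite /E [in sg 1 'X^(m.+2)]exprS sigmazM XE -!mul_polyC !rmorphM /= !rmorph_nat.
  by rewrite !exprS -[m.+2%:R]natr1; ring.
rewrite (leq_trans (size_polyD _ _)) // geq_max; apply/andP; split.
  by rewrite (leq_trans (size_polyMleq _ _)) // size_XsubC.
by rewrite (leq_trans (size_scale_leq _ _)) // size_polyXn.
Qed.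

Lemma poly_split m (p : {poly k}) : (size p <= m.+1)%N ->
  p = take_poly m p + p`_m *: 'X^m.
Proof.
move=> sp; apply/polyP => i; rewrite coefD coef_take_poly coefZ coefXn.
have [->|im] := eqVneq i m; first by rewrite ltnn mulr1 add0r.
rewrite mulr0 addr0; case: ltnP => // mi; rewrite nth_default //.
by rewrite (leq_trans sp) // ltn_neqAle eq_sym im.
Qed.

Lemma size_sdelta m (p : {poly k}) : (size p <= m.+1)%N -> (size (sdelta p) <= m)%N.
Proof.
elim: m p => [|m IHm] p sp.
  by rewrite [p]size1_polyC // sdeltaC size_poly0.
rewrite [p](poly_split sp) (linD (@sdeltaP _ _)) (linZ (@sdeltaP _ _)).
rewrite (leq_trans (size_polyD _ _)) // geq_max; apply/andP; split.
  by rewrite (leq_trans (IHm _ (size_take_poly _ _))).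
rewrite (leq_trans (size_scale_leq _ _)) //.
rewrite -[sdelta _](addrK ((m.+1%:R * h0) *: 'X^m)) (leq_trans (size_polyD _ _)) //.
rewrite geq_max size_polyN (leq_trans (size_sdelta_Xn m)) //=.
by rewrite (leq_trans (size_scale_leq _ _)) // size_polyXn.
Qed.

Lemma sdelta_top m (p : {poly k}) : (size p <= m.+2)%N ->
  (size (sdelta p + (m.+1%:R * h0 * p`_m.+1) *: 'X^m)%R <= m)%N.
Proof.
move=> sp; rewrite [in sdelta p](poly_split sp) (linD (@sdeltaP _ _)) (linZ (@sdeltaP _ _)).
rewrite mulrC -scalerA -addrA -scalerDr (leq_trans (size_polyD _ _)) // geq_max.
rewrite size_sdelta ?size_take_poly //=.
by rewrite (leq_trans (size_scale_leq _ _)) // size_sdelta_Xn.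
Qed.

Lemma natr_h0_neq0 m : m.+1%:R * h0 != 0.
Proof. by rewrite mulf_neq0 // (pcharf0P _).1. Qed.

(** The leading term of the image of h^(m+1) is -(m+1) h0 h^m with invertible coefficient, so the
    top term of z can be removed. *)
Lemma sdelta_surj (z : {poly k}) : exists q, sdelta q = z.
Proof.
have [m] := ubnPeq (size z); rewrite eq_sym => /eqP e; have : (size z <= m)%N by rewrite e.
move=> {e}; elim: m z => [|m IHm] z sz.
  by exists 0; rewrite (lin0 (@sdeltaP _ _)); apply/esym/eqP; rewrite -size_poly_eq0 -leqn0.
have [c cE] : exists c, c * (m.+1%:R * h0) = - z`_m.
  by exists (- (z`_m / (m.+1%:R * h0))); rewrite mulNr divfK ?natr_h0_neq0.
have [|q qE] := IHm (z - sdelta (c *: 'X^(m.+1))).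
  rewrite (linZ (@sdeltaP _ _)) {1}[z](poly_split sz) -addrA.
  have -> : z`_m *: 'X^m - c *: sdelta 'X^(m.+1) =
     - (c *: (sdelta 'X^(m.+1) + (m.+1%:R * h0) *: 'X^m)) :> {poly k}.
    move: (sdelta _) => D.
    by rewrite scalerDr scalerA cE scaleNr opprD opprK addrC.
  rewrite (leq_trans (size_polyD _ _)) // geq_max size_take_poly size_polyN /=.
  by rewrite (leq_trans (size_scale_leq _ _)) // size_sdelta_Xn.
exists (q + c *: 'X^(m.+1)); rewrite (linD (@sdeltaP _ _)) qE subrK.
by [].
Qed.

(** For non-constant p, the leading coefficient of p times -(deg p) h0 survives in degree deg p -
    1. *)
Lemma sdelta_eq0 p : sdelta p = 0 -> exists c, p = c%:P.
Proof.
move=> p0; exists p`_0; apply: size1_polyC; rewrite leqNgt; apply/negP => sp.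
have [m sE] : exists m, size p = m.+2 by case: (size p) sp => [|[|m]] // _; exists m.
have := @sdelta_top m p; rewrite sE leqnn p0 add0r => /(_ isT).
rewrite size_scale ?size_polyXn ?ltnn // mulf_neq0 ?natr_h0_neq0 //.
by have := lead_coef_eq0 p; rewrite lead_coefE sE /= -size_poly_eq0 sE => ->.
Qed.

Lemma coef_sumXn m (c : 'I_m -> k) (j : 'I_m) : (\sum_(i < m) c i *: 'X^i)`_j = c j.
Proof.
rewrite coef_sum (bigD1 j) //= coefZ coefXn eqxx mulr1 big1 ?addr0 // => i ij.
by rewrite coefZ coefXn (inj_eq val_inj) eq_sym (negbTE ij) mulr0.
Qed.

Lemma size_sumXn m (c : 'I_m -> k) : (size (\sum_(i < m) c i *: 'X^i)%R <= m)%N.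
Proof.
apply: (leq_trans (size_sum _ _ _)); apply/bigmax_leqP => i _.
by rewrite (leq_trans (size_scale_leq _ _)) // size_polyXn.
Qed.

Lemma mul_size_small m (f q r : {poly k}) :
  (size f).-1 = m -> f != 0 -> (size r <= m)%N -> r = f * q -> q = 0.
Proof.
move=> fm f0 sr rE; apply/eqP; apply: contraTT sr => q0.
rewrite rE size_mul // -ltnNge -fm.
move: f0 q0; rewrite -!size_poly_gt0; case: (size f) => // i _; case: (size q) => // j _.
by rewrite addSn addnS /= ltnS leq_addr.
Qed.

Lemma quot_span (f z : {poly k}) : f != 0 ->
  exists (c : 'I_(size f).-1 -> k) q, z = f * q + \sum_(i < (size f).-1) c i *: 'X^i.
Proof.
move=> f0; exists (fun i => (z %% f)`_i), (z %/ f).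
rewrite {1}(divp_eq z f) mulrC; congr (_ + _).
rewrite -poly_def; apply/polyP => i; rewrite coef_poly; case: ltnP => // mi.
rewrite nth_default // (leq_trans _ mi) // -ltnS prednK ?lt0n ?size_poly_eq0 //.
by rewrite ltn_modp.
Qed.

Lemma quot_free (f q : {poly k}) (c : 'I_(size f).-1 -> k) : f != 0 ->
  \sum_(i < (size f).-1) c i *: 'X^i = f * q -> forall i, c i = 0.
Proof.
move=> f0 e i; have q0 := mul_size_small erefl f0 (size_sumXn c) e.
by rewrite -(coef_sumXn c) e q0 mulr0 coef0.
Qed.

(** As sigma - 1 is onto with kernel k, it identifies k[h]/(k + f k[h]) with k[h]/(sigma - 1)(f
    k[h]), so h, ..., h^(deg f - 1) provide the basis. For constant f the truncated subtraction
    correctly gives 0. *)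
Lemma dquot_span (f z : {poly k}) : f != 0 ->
  exists (c : 'I_((size f).-1 - 1) -> k) q,
    z = sdelta (f * q) + \sum_(i < (size f).-1 - 1) c i *: sdelta 'X^(i.+1).
Proof.
move=> f0; have [y <-] := sdelta_surj z.
have [c [q ->]] := quot_span y f0.
move: c; case: (size f).-1 => [|m] c.
  exists (fun=> 0), q; rewrite !big_ord0 !addr0 //.
rewrite subSS subn0.
exists (fun i => c (lift ord0 i)), q; rewrite big_ord_recl expr0 alg_polyC.
rewrite !(linD (@sdeltaP _ _)) sdeltaC add0r (lin_sum (@sdeltaP _ _)); congr (_ + _).
by apply: eq_bigr => i _; rewrite (linZ (@sdeltaP _ _)).
Qed.

Lemma dquot_free (f q : {poly k}) (c : 'I_((size f).-1 - 1) -> k) : f != 0 ->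
  \sum_(i < (size f).-1 - 1) c i *: sdelta 'X^(i.+1) = sdelta (f * q) ->
  forall i, c i = 0.
Proof.
move=> f0 e i; have m0 : (0 < (size f).-1)%N.
  by have := leq_ltn_trans (leq0n i) (ltn_ord i); rewrite subn_gt0 => /ltnW.
have : sdelta (\sum_(i < (size f).-1 - 1) c i *: 'X^(i.+1) - f * q) = 0.
  rewrite (linB (@sdeltaP _ _)) -e (lin_sum (@sdeltaP _ _)); apply/eqP.
  by rewrite subr_eq0; apply/eqP/eq_bigr => j _; rewrite (linZ (@sdeltaP _ _)).
(* The combination is a multiple f q only up to a constant; comparing degrees then forces q = 0. *)
case/sdelta_eq0 => b bE.
have fE : \sum_(i < (size f).-1 - 1) c i *: 'X^(i.+1) - b%:P = f * q.
  by rewrite -bE opprB addrC subrK.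
have q0 : q = 0.
  apply: (mul_size_small erefl f0 _ fE).
  rewrite (leq_trans (size_polyD _ _)) // geq_max; apply/andP; split.
    apply: (leq_trans (size_sum _ _ _)); apply/bigmax_leqP => j _.
    rewrite (leq_trans (size_scale_leq _ _)) // size_polyXn.
    by have := ltn_ord j; lia.
  by rewrite size_polyN (leq_trans (size_polyC_leq1 _)).
move/(congr1 (fun p : {poly k} => p`_i.+1)): fE.
rewrite q0 mulr0 coef0 coefB coefC /= subr0 coef_sum (bigD1 i) //= coefZ coefXn eqxx mulr1.
rewrite big1 ?addr0 // => j ij.
by rewrite coefZ coefXn eqSS (inj_eq val_inj) eq_sym (negbTE ij) mulr0.
Qed.

(** * Syzygies of a and a', and the homology degree by degree *)

Local Notation a' := (a^`()).
Local Notation g := (gcdp a a').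
Local Notation small_bd := (@small_bd k a h0).

Lemma gcd_deriv_neq0 : g != 0.
Proof. by rewrite gcdp_eq0 negb_and a0. Qed.

Lemma gcd_deriv_bezout : exists u v, u * a + v * a' = g.
Proof.
have [[u v] /=] := Bezoutp a a'; rewrite eqp_sym => /eqpf_eq[c _ ->].
by exists (c *: u), (c *: v); rewrite scalerDr !scalerAl.
Qed.

Lemma small_hdim0 : hdim small_bd 0 ((size a).-1 - 1).
Proof.
exists (fun i => sdelta 'X^(i.+1)); split=> // [z _|c].
  have [c [q ->]] := dquot_span z a0.
  by exists c, (q, 0); rewrite /= addrK.
by move=> [[t b] /= e]; apply: dquot_free a0 (esym e).
Qed.

Local Notation b := (a %/ g).
Local Notation b' := (a' %/ g).

Lemma div_gcd_derivE : a = b * g. Proof. by rewrite divpK ?dvdp_gcdl. Qed.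
Lemma deriv_div_gcd_derivE : a' = b' * g. Proof. by rewrite divpK ?dvdp_gcdr. Qed.
Lemma div_gcd_deriv_neq0 : b != 0.
Proof. by apply: contraNneq a0 => b0; rewrite div_gcd_derivE b0 mul0r. Qed.

(** Substitutes a = b g and a' = b' g with b, b', g as free variables, leaving an identity of
    commutative rings. *)
Ltac gcd_ring := try (move: (\sum_(i < _) _) => ?); move: div_gcd_derivE deriv_div_gcd_derivE;
  move: g (a %/ g) (a' %/ g) => G B B'; move: a' => A'; let e1 := fresh in let e2 := fresh in
  intros e1 e2; rewrite ?e2 ?e1; ring.

(** Cancelling g leaves b' x = b y with b and b' coprime, so b divides x. *)
Lemma syzygy (x y : {poly k}) : a' * x = a * y -> exists q, x = b * q /\ y = b' * q.
Proof.
move=> e0; have e : b' * x = b * y.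
  by apply: (mulIf gcd_deriv_neq0); rewrite mulrAC -deriv_div_gcd_derivE [RHS]mulrAC -div_gcd_derivE.
have bx : b %| x.
  have cop : coprimep b b' by rewrite coprimep_div_gcd // a0.
  by rewrite -(Gauss_dvdpr _ cop) e dvdp_mulr.
exists (x %/ b); rewrite mulrC divpK //; split=> //.
by apply: (mulfI div_gcd_deriv_neq0); rewrite -e mulrCA [b * _]mulrC divpK.
Qed.

Lemma bezout_span q : exists x y, a * y - a' * x = g * q.
Proof.
have [u [v <-]] := gcd_deriv_bezout; exists (- (v * q)), (u * q).
by ring.
Qed.

Lemma fstP (U V : lmodType k) : linear (@fst U V). Proof. by []. Qed.
Lemma sndP (U V : lmodType k) : linear (@snd U V). Proof. by []. Qed.

Lemma fst_sum (U V : lmodType k) m (c : 'I_m -> k) (u : 'I_m -> U * V) :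
  (\sum_(i < m) c i *: u i).1 = \sum_(i < m) c i *: (u i).1.
Proof. by rewrite (lin_sum (@fstP _ _)). Qed.
Lemma snd_sum (U V : lmodType k) m (c : 'I_m -> k) (u : 'I_m -> U * V) :
  (\sum_(i < m) c i *: u i).2 = \sum_(i < m) c i *: (u i).2.
Proof. by rewrite (lin_sum (@sndP _ _)). Qed.

Lemma sum_mull m (c : 'I_m -> k) (f : {poly k}) :
  \sum_(i < m) c i *: (f * 'X^i) = f * \sum_(i < m) c i *: 'X^i.
Proof. by rewrite mulr_sumr; apply: eq_bigr => i _; rewrite scalerAr. Qed.

(** For a cycle (t, z) the product a t is constant, so t = 0 because a is not constant. By Bezout,
    the boundaries fill (sigma - 1)(g k[h]) in the second coordinate. *)
Lemma small_hdim1 : (1 < size a)%N -> hdim small_bd 1 ((size g).-1 - 1).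
Proof.
move=> sa; exists (fun i => (0, sdelta 'X^(i.+1)) : small k 1); split=> [i|[t z] /= zC|c].
- by rewrite /= mulr0 (lin0 (@sdeltaP _ _)).
- have t0 : t = 0.
    have [c e] := sdelta_eq0 zC; apply/eqP; apply: contraTT sa => t0.
    rewrite -leqNgt; have := size_mul a0 t0; rewrite e.
    have := size_polyC_leq1 c; move: t0; rewrite -size_poly_gt0.
    by case: (size t) => // j _ c1; rewrite addnS /= => E; rewrite (leq_trans (leq_addr j _)) // -E.
  have [c [q ->]] := dquot_span z gcd_deriv_neq0; have [x [y xyE]] := bezout_span q.
  exists c, (- x, - y); apply: pairP; rewrite /= ?fst_sum ?snd_sum /=.
    by rewrite t0 sub0r big1 ?oppr0 // => i _; rewrite scaler0.
  by rewrite addrK -xyE; congr sdelta; ring.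
- move=> [[x y] /(congr1 snd)]; rewrite snd_sum /= => e.
  apply: (dquot_free (q := b' * x - b * y) gcd_deriv_neq0); rewrite -e; congr sdelta.
  by gcd_ring.
Qed.

(** Syzygies are the multiples of (b, b') and boundaries those of (a, a') = g (b, b'), so the
    quotient is k[h]/(g). *)
Lemma syz_span (z : {poly k} * {poly k}) : a' * z.1 = a * z.2 ->
  exists (c : 'I_(size g).-1 -> k) t,
    (- (a * t), - (a' * t)) = z - \sum_(i < (size g).-1) c i *: (b * 'X^i, b' * 'X^i).
Proof.
case: z => x y /= /syzygy[q [-> ->]]; have [c [s ->]] := quot_span q gcd_deriv_neq0.
exists c, (- s); apply: pairP; rewrite /= ?fst_sum ?snd_sum /= sum_mull.
  by gcd_ring.
by gcd_ring.
Qed.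

Lemma syz_free (c : 'I_(size g).-1 -> k) t :
  (- (a * t), - (a' * t)) = \sum_(i < (size g).-1) c i *: (b * 'X^i, b' * 'X^i) ->
  forall i, c i = 0.
Proof.
move=> /(congr1 fst); rewrite fst_sum /= sum_mull => e.
apply: (quot_free (q := - t) gcd_deriv_neq0); apply: (mulfI div_gcd_deriv_neq0).
by rewrite -e; clear e; gcd_ring.
Qed.

Lemma syz_cycle i : a' * (b * 'X^i) = a * (b' * 'X^i).
Proof. by gcd_ring. Qed.

(** In even degrees this is the syzygy quotient. In odd degrees a cycle has first coordinate 0, and
    its second is taken modulo the ideal (a, a') = (g). *)
Lemma small_hdim_ge3 m : hdim small_bd m.+3 (size g).-1.
Proof.
case om: (odd m).
  exists (fun i => (b * 'X^i, b' * 'X^i) : small k m.+3); split=> [i|z|c].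
  - by rewrite /= om /= syz_cycle subrr.
  - rewrite /= om => /(congr1 snd) /= /eqP; rewrite subr_eq0 => /eqP/esym.
    case/syz_span => c [t e]; exists c, (t, 0); rewrite /= om /=; exact: e.
  - by case=> [[t s]] /=; rewrite om /=; apply: syz_free.
exists (fun i => (0, 'X^i) : small k m.+3); split=> [i|[t z]|c].
- by rewrite /= om /= !mulr0 oppr0.
- rewrite /= om => /(congr1 fst) /= /eqP.
  rewrite oppr_eq0 mulf_eq0 (negbTE a0) /= => /eqP t0.
  have [c [q ->]] := quot_span z gcd_deriv_neq0; have [x [y xyE]] := bezout_span q.
  exists c, (x, y); rewrite /= om; apply: pairP; rewrite /= ?fst_sum ?snd_sum /=.
    by rewrite t0 sub0r big1 ?oppr0 // => i _; rewrite scaler0.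
  by rewrite xyE addrK.
- move=> [[x y]]; rewrite /= om => /(congr1 snd); rewrite snd_sum /= => e.
  apply: (quot_free (q := b * y - b' * x) gcd_deriv_neq0); rewrite -e.
  by gcd_ring.
Qed.

(** Unlike in higher even degrees, a cycle (x, y) only has a' x - a y constant; but the non-constant
    g divides this constant, which is therefore 0. *)
Lemma small_hdim2 : (1 < size g)%N -> hdim small_bd 2 (size g).-1.
Proof.
move=> sg; exists (fun i => (b * 'X^i, b' * 'X^i) : small k 2); split=> [i|z|c].
- by rewrite /= syz_cycle subrr (lin0 (@sdeltaP _ _)).
- move=> /(congr1 snd) /sdelta_eq0[c cE].
  have c0 : c%:P = 0 :> {poly k}.
    apply/eqP; rewrite -size_poly_eq0 -leqn0 leqNgt; apply: contraTN sg => c0.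
    rewrite -leqNgt; have gc : g %| c%:P.
      by rewrite -cE dvdp_sub ?dvdp_mulr ?dvdp_gcdl ?dvdp_gcdr.
    apply: leq_trans (size_polyC_leq1 c); apply: dvdp_leq gc.
    by rewrite -size_poly_gt0.
  have [c' [t e]] := @syz_span z (subr0_eq (etrans cE c0)).
  by exists c', (t, 0); exact: e.
- by case=> [[t s]] /=; apply: syz_free.
Qed.

(** For a unit g the syzygy quotient vanishes, but a' x - a y may be any constant: a Bezout pair of
    value 1 spans the homology. *)
Lemma small_hdim2_coprime : size g = 1%N -> hdim small_bd 2 1.
Proof.
move=> sg; have [x [y xyE]] : exists x y, a' * x - a * y = 1.
  have [c c0 gE] : exists2 c, c != 0 & g = c%:P by apply/size_poly1P; rewrite sg.
  have [x [y xyE]] := bezout_span (c^-1)%:P; exists (- x), (- y).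
  by rewrite !mulrN opprK addrC xyE {1}gE -polyCM divff.
exists (fun=> (x, y) : small k 2); split=> [i|z|c].
- by rewrite /= xyE (sdeltaC 1).
- move=> /(congr1 snd) /sdelta_eq0[c cE].
  have [|c' [t e]] := @syz_span (z - c *: (x, y)).
    apply/eqP; rewrite -subr_eq0; apply/eqP.
    transitivity (a' * z.1 - a * z.2 - c%:P * (a' * x - a * y)); first by rewrite /= -!mul_polyC; ring.
    by rewrite xyE cE mulr1 subrr.
  exists (fun=> c), (t, 0); rewrite big_ord1 /=; etransitivity; first exact: e.
  (* g has degree 0, so the index set is empty. *)
  rewrite big1 ?subr0 // => -[i il] _; exfalso; move: il; rewrite sg.
  by [].
- case=> [[t s]] /=; rewrite big_ord1 => e i; rewrite ord1.
  have e1 : - (a * t) = c ord0 *: x := congr1 fst e.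
  have e2 : - (a' * t) = c ord0 *: y := congr1 snd e.
  (* The form a' u1 - a u2 takes the value 1 on the chosen class and 0 on boundaries. *)
  apply/eqP; rewrite -(polyC_eq0 (c ord0)) -[_%:P]mulr1 -xyE; apply/eqP.
  transitivity (a' * (c ord0 *: x) - a * (c ord0 *: y)); first by rewrite -!mul_polyC; ring.
  by rewrite -e1 -e2; ring.
Qed.

End SmallHomology.

(** * Transport to the Hochschild complex and conclusion *)

Lemma hdim_HH (k : fieldType) (a : {poly k}) (h0 : k) n r :
  [pchar k] =i pred0 -> a != 0 -> h0 != 0 -> hdim (@small_bd k a h0) n r -> HH_dim a h0 n r.
Proof.
move=> chark a0 h00 /(hdim_small a0 chark h00) sm; apply: (hdim_bar_HH (a0 := a0)).
apply: (@hdim_resolution k _ (gwa_resolution h0 a0) (bar_resolution (gwa_basis h0 a0))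
  (fun=> [tuple] : 0.-tuple _) (fun=> tt)) sm => [[]//|t].
by rewrite [t]tuple0.
Qed.

Theorem theorem1p1 (k : fieldType) (a : {poly k}) (h0 : k) :
  [pchar k] =i pred0 -> (1 < size a)%N -> h0 != 0 ->
  let n := (size a).-1 in
  let d := (size (gcdp a a^`())).-1 in
  (d = 0%N ->
     [/\ HH_dim a h0 0 (n - 1), HH_dim a h0 2 1
       & forall i : nat, i != 0%N -> i != 2%N -> HH_dim a h0 i 0]) /\
  ((1 <= d)%N ->
     [/\ HH_dim a h0 0 (n - 1), HH_dim a h0 1 (d - 1)
       & forall i : nat, (2 <= i)%N -> HH_dim a h0 i d]).
Proof.
move=> chark sa h00 n d.
have a0 : a != 0 by rewrite -size_poly_gt0 ltnW.
have H i r : hdim (@small_bd k a h0) i r -> HH_dim a h0 i r by exact: hdim_HH.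
split=> [d0|d1]; split.
- exact/H/small_hdim0.
- apply/H/small_hdim2_coprime => //; move: d0 (gcd_deriv_neq0 a0); rewrite -size_poly_gt0 /d.
  by case: (size _) => // -[].
- move=> [|[|[|i]]] // _ _; apply: H.
    (* For d = 0 the truncated d - 1 is 0. *)
    by have := small_hdim1 a0 chark h00 sa; rewrite -/d d0.
  by have := small_hdim_ge3 h0 a0 i; rewrite -/d d0.
- exact/H/small_hdim0.
- exact/H/small_hdim1.
- move=> [|[|[|i]]] // _; apply: H; last exact: small_hdim_ge3.
  by apply: small_hdim2 => //; move: d1; rewrite /d; case: (size _) => [|[]].
Qed.
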